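(* Let $\Omega\subset\mathbb R^2$ be a compact convex body with nonempty interior. Then there exists a constant $C_\Omega<\infty$ (depending only on $\Omega$) such that for every sufficiently large $L$ there is a finite union of line segments $S\subset\Omega$ satisfying \[ \mathcal H^1(S)=L \quad\text{and}\quad \operatorname{disc}_\Omega(S)\le C_\Omega\, L^{1/5}(\log L)^{2/5}. \]
   Context: $|\Omega|$ denotes the area of $\Omega$ and $\mathcal H^1$ the one-dimensional Hausdorff measure (length). Let $\mathcal L$ be the space of unoriented lines in $\mathbb R^2$ with the usual motion-invariant measure. For a finite union of line segments $S\subset\Omega$ with $\mathcal H^1(S)=L$, and a line $\ell$, let $\#(\ell\cap S)$ be the number of transverse intersections of $\ell$ with $S$, counted with multiplicity (the set of lines containing a segment of $S$, passing through an endpoint of a segment, or through an intersection point of two segments has measure zero and is ignored). The Buffon discrepancy is \[ \operatorname{disc}_\Omega(S)=\operatorname*{ess\,sup}_{\ell\in\mathcal L}\left|\#(\ell\cap S)-\frac{2L}{\pi|\Omega|}\,\mathcal H^1(\ell\cap\Omega)\right|. \] *)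

(* Defs.v *)
From HB Require Import structures.
From mathcomp Require Import all_boot all_order all_algebra.
From mathcomp Require Import all_classical all_reals all_analysis.
Set Implicit Arguments. Unset Strict Implicit. Unset Printing Implicit Defensive.
Import Order.TTheory GRing.Theory Num.Theory.
Import numFieldNormedType.Exports.
Local Open Scope classical_set_scope.
Local Open Scope ring_scope.

Section Buffon.
Variable R : realType.

Definition pt := (R * R)%type.

Definition leb2 := ((@lebesgue_measure R) \x (@lebesgue_measure R))%E.

Definition area (Om : set pt) : R := fine (leb2 Om).

Definition convex_set2 (Om : set pt) : Prop :=
  forall x y, Om x -> Om y -> forall t : R, 0 <= t <= 1 ->
    Om ((1 - t) * x.1 + t * y.1, (1 - t) * x.2 + t * y.2).

Definition convex_body (Om : set pt) : Prop :=
  compact Om /\ convex_set2 Om /\ Om^° !=set0.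

Definition segment := (pt * pt)%type.

Definition seg_pts (s : segment) : set pt :=
  [set x | exists2 t : R, 0 <= t <= 1 &
     x = ((1 - t) * s.1.1 + t * s.2.1, (1 - t) * s.1.2 + t * s.2.2)].

Definition seg_len (s : segment) : R :=
  Num.sqrt ((s.2.1 - s.1.1) ^+ 2 + (s.2.2 - s.1.2) ^+ 2).

(* the unoriented line with normal direction angle th in [0,pi) and signed
   distance p to the origin: { x | x . (cos th, sin th) = p } *)
Definition line (th p : R) : set pt :=
  [set x | x.1 * cos th + x.2 * sin th = p].

(* a finite union of segments, given as a list of segments which pairwise
   meet in at most one point (so H^1 of the union is the sum of lengths) *)
Definition non_overlapping (S : seq segment) : Prop :=
  forall i j, (i < size S)%N -> (j < size S)%N -> i <> j ->
    forall x y, (seg_pts (nth (0,0,(0,0)) S i) `&` seg_pts (nth (0,0,(0,0)) S j)) x ->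
                (seg_pts (nth (0,0,(0,0)) S i) `&` seg_pts (nth (0,0,(0,0)) S j)) y ->
                x = y.

Definition total_length (S : seq segment) : R := \sum_(s <- S) seg_len s.

Definition cross_count (s : segment) (th p : R) : R :=
  if asbool (seg_pts s `&` line th p !=set0 /\ ~ (seg_pts s `<=` line th p))
  then 1 else 0.

(* #(l \cap S), counted with multiplicity *)
Definition inter_count (S : seq segment) (th p : R) : R :=
  \sum_(s <- S) cross_count s th p.

(* H^1(l \cap Om): 1-d Lebesgue measure of the line intersected with Om,
   parametrized by arc length *)
Definition chord (Om : set pt) (th p : R) : R :=
  fine (lebesgue_measure
    [set t : R | Om (p * cos th - t * sin th, p * sin th + t * cos th)]).

(* disc_Om(S) <= c : the essential supremum over lines (w.r.t. the
   motion-invariant measure dp dth on [0,pi) x R) is at most c *)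
Definition disc_le (Om : set pt) (S : seq segment) (c : R) : Prop :=
  leb2.-negligible
    [set z : pt | (0 <= z.1 < pi) /\
       c < `| inter_count S z.1 z.2
              - 2 * total_length S / (pi * area Om) * chord Om z.1 z.2 |].

End Buffon.

(* Main.v *)
(** For [n] equally spaced directions take the chords of [Om] along a lattice of
    parallel lines of spacing [d]. A line with chord [w] at angle [phi] to such a family
    crosses it [w |sin phi| / d] times up to an error of at most 1, and the sum of
    [|sin|] over [n] equally spaced angles is [2 n / pi] up to [O(1 / n)], so the
    discrepancy is at most [O(L / n ^ 2)] plus the sum of the [n] rounding errors.
    Shifting the families independently gives these errors mean zero, so that by
    Hoeffding's bound, applied simultaneously to polynomially many test lines, some
    choice of the shifts makes their sum [O(sqrt (n log L))]. With
    [n ~ L ^ (2 / 5) / (log L) ^ (1 / 5)] both terms are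
    [L ^ (1 / 5) (log L) ^ (2 / 5)]. The total length is one more test; its deviation
    from [L] is repaired with few short segments in a further direction. *)
Require Import Defs.
From HB Require Import structures.
From mathcomp Require Import all_boot all_order all_algebra.
From mathcomp Require Import all_classical all_reals all_analysis.
From mathcomp Require Import measurable_realfun ring lra.
Set Implicit Arguments. Unset Strict Implicit. Unset Printing Implicit Defensive.
Import Order.TTheory GRing.Theory Num.Theory.
Import numFieldNormedType.Exports.
Local Open Scope classical_set_scope.
Local Open Scope ring_scope.

(** A line matters only through the two ends of its chord: their shadows on the normals of the [n]
    families have width chord times |sin| ([crossing_width]), and up to boundary cases the crossings
    are the lattice points in these shadows. Rounding the ends to a grid of mesh [d / (8 * n)] thus
    turns all lines into [O((n / d) ^ 4)] tests, at a total cost of 2. The shifts are multiples of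
    [d / n]. The [n] shifted copies of one lattice then interleave to a lattice of spacing [d / n],
    so the bound [B] that holds for each single rounding error also holds for their sum over all
    shifts. The mean error is therefore at most [B / n] per family, [B] in all, and Hoeffding's
    argument becomes a finite average over choice functions. Total length is treated alike, since
    the chords along a lattice of any spacing have length area over spacing up to [O(1)]. Segments
    can be added but not removed, so the lattices aim at the length [L - kap], where [kap] bounds
    the fluctuation, and the remaining deficit lies between 0 and [2 * kap]. *)

Section Counting.
Variable R : realType.
Implicit Types (N : nat) (x y d p lo hi : R).

(** The second clause carries the induction past the point where every index is counted. *)
Lemma count_lt N x : -1 < x ->
  (x <= N%:R -> x <= \sum_(i < N) (i%:R < x)%R%:R < x + 1) /\
  (N%:R <= x -> \sum_(i < N) (i%:R < x)%R%:R = N%:R :> R).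
Proof.
move=> x1; elim: N => [|N [IH1 IH2]]; first by rewrite big_ord0; split => ?; lra.
rewrite big_ord_recr /= -natr1; split => xN.
  have [xN'|Nx] := leP x N%:R; first by rewrite addr0; exact: IH1.
  by rewrite (IH2 (ltW Nx)) /=; apply/andP; split; lra.
have Nx : N%:R < x by lra.
by rewrite Nx (IH2 (ltW Nx)).
Qed.

Lemma count_le N x : -1 <= x ->
  (x < N%:R -> x < \sum_(i < N) (i%:R <= x)%R%:R <= x + 1) /\
  (N%:R <= x + 1 -> \sum_(i < N) (i%:R <= x)%R%:R = N%:R :> R).
Proof.
move=> x1; elim: N => [|N [IH1 IH2]]; first by rewrite big_ord0; split => ?; lra.
rewrite big_ord_recr /= -natr1; split => xN.
  have [Nx|xN'] := leP N%:R x; last by rewrite addr0; exact: IH1.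
  by rewrite IH2 /=; [apply/andP; split|]; lra.
have Nx : N%:R <= x by lra.
by rewrite Nx IH2 //; lra.
Qed.

(** The bound [-1 <= y - x] admits a slightly reversed interval, which holds no integer and misses
    its signed length by at most 1. Shrunken shadows can be of this kind. *)
Lemma count_itv N x y : -1 < x -> y < N%:R -> -1 <= y - x ->
  `|\sum_(i < N) (x <= i%:R <= y)%R%:R - (y - x)| <= 1.
Proof.
move=> x1 yN yx; have [xy|xy] := leP x y.
  have -> : \sum_(i < N) (x <= i%:R <= y)%R%:R =
      \sum_(i < N) (i%:R <= y)%R%:R - \sum_(i < N) (i%:R < x)%R%:R :> R.
    rewrite -sumrB; apply: eq_bigr => i _.
    have [xi|ix] := leP x i%:R; first by rewrite subr0.
    by rewrite (le_trans (ltW ix) xy) subrr.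
  have [|A _] := @count_le N y; first by lra.
  have [//|B _] := @count_lt N x.
  have := A yN; have := B (ltW (le_lt_trans xy yN)); rewrite ler_norml => ? ?.
  by apply/andP; split; lra.
rewrite big1 ?sub0r ?normrN => [|i _]; first by rewrite ler_norml; apply/andP; split; lra.
by case: andP => // -[A B]; move: (le_trans A B); rewrite leNgt xy.
Qed.

(** The bounds on [p] put the neighbours of the finite lattice on either side outside the interval,
    so no lattice point of it is lost by truncation. *)
Lemma count_lattice N p d lo hi : 0 < d -> p - d < lo -> hi < p + N%:R * d ->
  - d <= hi - lo ->
  `|\sum_(i < N) (lo <= p + i%:R * d <= hi)%R%:R - (hi - lo) / d| <= 1.
Proof.
move=> d0 plo hip lohi.
have E i : (lo <= p + i%:R * d <= hi) = ((lo - p) / d <= i%:R <= (hi - p) / d).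
  by rewrite ler_pdivrMr // ler_pdivlMr // lerBlDl lerBrDl.
rewrite (eq_bigr (fun i : 'I_N => ((lo - p) / d <= i%:R <= (hi - p) / d)%R%:R));
  last by move=> i _; rewrite E.
have -> : (hi - lo) / d = (hi - p) / d - (lo - p) / d by rewrite -mulrBl; congr (_ / _); ring.
apply: count_itv.
- by rewrite ltr_pdivlMr //; lra.
- by rewrite ltr_pdivrMr //; lra.
- by rewrite -mulrBl ler_pdivlMr //; lra.
Qed.

End Counting.

(** * A Hoeffding bound by averaging over choice functions *)

Section Derandomization.
Variable R : realType.

(** From [1 - y <= expR (- y)] one gets [expR y <= 1 / (1 - y)], and the quadratic dominates this
    fraction on the given range. *)
Lemma expR_le_quad (y : R) : `|y| <= 1 / 2 -> expR y <= 1 + y + 2 * y ^+ 2.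
Proof.
move=> y1; have /ler_normlP[ym yp] := y1.
have h := expR_ge1Dx (- y); rewrite expRN in h.
have e0 := expR_gt0 y.
have h1 : expR y * (1 - y) <= 1.
  by rewrite -[leRHS](mulfV (lt0r_neq0 e0)) ler_wpM2l // ltW.
have h2 : 1 <= (1 + y + 2 * y ^+ 2) * (1 - y).
  have -> : (1 + y + 2 * y ^+ 2) * (1 - y) = 1 + y ^+ 2 * (1 - 2 * y) by ring.
  by rewrite lerDl mulr_ge0 ?sqr_ge0 //; lra.
by rewrite -(@ler_pM2r _ (1 - y)) ?(le_trans h1) //; lra.
Qed.

(* Derandomized Hoeffding bound: the exponential moments of all tests are
   averaged over all choice functions at once. *)
Lemma balanced_choice (n m : nat) (T : finType) (X : T -> 'I_n -> 'I_m -> R)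
    (B lam e tau : R) :
  (0 < m)%N -> (0 < #|T|)%N -> 0 < lam -> lam * B <= 1 / 2 ->
  (forall t k j, `|X t k j| <= B) ->
  (forall t k, \sum_j X t k j <= e * m%:R) ->
  #|T|%:R <= expR tau ->
  exists w : {ffun 'I_n -> 'I_m}, forall t,
    \sum_k X t k (w k) <= tau / lam + n%:R * e + 2 * n%:R * lam * B ^+ 2.
Proof.
move=> m0 T0 l0 lB XB Xe Ttau; apply: contrapT => nex.
set s := tau / lam + _ + _ in nex.
have m0R : 0 < m%:R :> R by rewrite ltr0n.
(* If every choice fails some test, each one contributes more than [expR (lam * s)] to the sum of
   the exponential moments. *)
have big (w : {ffun 'I_n -> 'I_m}) : expR (lam * s) < \sum_t expR (lam * \sum_k X t k (w k)).
  have [t ts] : exists t, s < \sum_k X t k (w k).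
    apply: contrapT => H; apply: nex; exists w => t; rewrite leNgt; apply/negP => H'.
    by apply: H; exists t.
  rewrite (bigD1 t) //= (@lt_le_trans _ _ (expR (lam * \sum_k X t k (w k)))) //.
    by rewrite ltr_expR ltr_pM2l.
  by rewrite lerDl sumr_ge0 // => i _; exact: expR_ge0.
(* [q] bounds the average over the [m] values of one coordinate: the linear terms give [lam * e],
   the quadratic ones the rest. *)
pose q := expR (lam * e + 2 * lam ^+ 2 * B ^+ 2).
have one t k : \sum_j expR (lam * X t k j) <= m%:R * q.
  have B0 j : X t k j ^+ 2 <= B ^+ 2.
    by rewrite -real_normK ?num_real // lerXn2r ?nnegrE // (le_trans _ (XB t k j)).
  apply: (@le_trans _ _ (\sum_j (1 + lam * X t k j + 2 * lam ^+ 2 * B ^+ 2))).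
    apply: ler_sum => j _; apply: le_trans (expR_le_quad _) _.
      by rewrite normrM gtr0_norm // (le_trans _ lB) // ler_pM2l.
    by rewrite lerD2l exprMn mulrA ler_wpM2l // mulr_ge0 // sqr_ge0.
  rewrite !big_split /= -mulr_sumr !sumr_const !card_ord.
  have h : lam * \sum_j X t k j <= lam * (e * m%:R) by rewrite ler_pM2l.
  apply: (@le_trans _ _ (m%:R * (1 + (lam * e + 2 * lam ^+ 2 * B ^+ 2)))); last first.
    by rewrite ler_pM2l // expR_ge1Dx.
  by rewrite -[_ *+ m]mulr_natr -[(_ * B ^+ 2) *+ m]mulr_natr; lra.
have all t : \sum_(w : {ffun 'I_n -> 'I_m}) expR (lam * \sum_k X t k (w k)) <= (m%:R * q) ^+ n.
  rewrite (eq_bigr (fun w : {ffun 'I_n -> 'I_m} => \prod_k expR (lam * X t k (w k)))); last first.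
    by move=> w _; rewrite mulr_sumr expR_sum.
  (* A sum over choice functions of products is the product of the one-coordinate sums; this stands
     in for independence. *)
  rewrite -(bigA_distr_bigA (fun k j => expR (lam * X t k j))).
  rewrite -[X in _ ^+ X](card_ord n) -prodr_const; apply: ler_prod => k _.
  by rewrite one sumr_ge0 // => j _; exact: expR_ge0.
have up : \sum_(w : {ffun 'I_n -> 'I_m}) \sum_t expR (lam * \sum_k X t k (w k)) <= #|T|%:R * (m%:R * q) ^+ n.
  by rewrite exchange_big /= mulr_natl -sumr_const ler_sum.
have low : (m ^ n)%:R * expR (lam * s) <
    \sum_(w : {ffun 'I_n -> 'I_m}) \sum_t expR (lam * \sum_k X t k (w k)).
  have -> : (m ^ n)%:R * expR (lam * s) = \sum_(w : {ffun 'I_n -> 'I_m}) expR (lam * s).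
    by rewrite sumr_const card_ffun !card_ord mulr_natl.
  apply: ltr_sum => [|w _]; last exact: big.
  by apply/hasP; exists [ffun=> Ordinal m0] => //; rewrite mem_index_enum.
(* [s] is such that [lam * s = tau + n * (lam * e + 2 * lam ^+ 2 * B ^+ 2)], hence
   [#|T| * q ^+ n <= expR (lam * s)], a contradiction. *)
have := lt_le_trans low up.
rewrite exprMn -natrX mulrCA ltr_pM2l; last by rewrite ltr0n expn_gt0 m0.
apply/negP; rewrite -leNgt /q -expRM_natl.
apply: (le_trans (ler_wpM2r (expR_ge0 _) Ttau)); rewrite -expRD ler_expR /s.
by rewrite le_eqVlt; apply/orP; left; apply/eqP; field; rewrite gt_eqF.
Qed.

End Derandomization.

(** * The sum of |sin| over equally spaced angles *)

Section Trig.
Variable R : realType.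
Implicit Types x y th : R.

Lemma sin_lex x : 0 <= x -> sin x <= x.
Proof.
rewrite le_eqVlt => /predU1P[<-|x0]; first by rewrite sin0.
have dsin y : y \in `]0, x[ -> is_derive y 1 (@sin R) (cos y).
  by move=> _; exact: is_derive_sin.
have csin : {within `[0, x], continuous (@sin R)}.
  by apply: continuous_subspaceT => y; exact: continuous_sin.
have [c cx E] := MVT x0 dsin csin.
by move: E; rewrite sin0 !subr0 => ->; rewrite ler_piMl ?cos_le1 // ltW.
Qed.

Lemma mul_cos_le_sin x : 0 <= x <= pi / 2 -> x * cos x <= sin x.
Proof.
move=> /andP[]; rewrite le_eqVlt => /predU1P[<-|x0] xpi; first by rewrite sin0 mul0r.
have df y : y \in `]0, x[ -> is_derive y 1 (fun y => sin y - y * cos y) (y * sin y).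
  by move=> _; apply: is_derive_eq; rewrite /GRing.scale /=; ring.
have cf : {within `[0, x], continuous (fun y => sin y - y * cos y)}.
  apply: derivable_within_continuous => y _.
  by apply: derivableB; [exact: derivable_sin|apply: derivableM; [exact: derivable_id|exact: derivable_cos]].
have [c cx E] := MVT x0 df cf.
move: E cx; rewrite sin0 mul0r !subr0 in_itv /= => E /andP[c0 cx].
rewrite -subr_ge0 E !mulr_ge0 ?(ltW c0) ?(ltW x0) // sin_ge0_pi // (ltW c0) /=.
by have := @pi_gt0 R; lra.
Qed.

(** The sum of sines below has the closed form [cos y / sin x] with [x = pi / (2 n)], to be compared
    with [2 n / pi = x^-1]. *)
Lemma inv_sin_bounds x y : 0 < x <= pi / 2 -> `|y| <= x ->
  `|cos y / sin x - x^-1| <= x.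
Proof.
move=> /andP[x0 xpi] yx.
have pi0 := @pi_gt0 R.
have sx0 : 0 < sin x by apply: sin_gt0_pi; lra.
have cyx : cos x <= cos y.
  rewrite -(cos_norm y); have [->//|ne] := eqVneq `|y| x.
  apply/ltW; rewrite ltr_cos ?lt_neqAle ?ne ?yx // in_itv /= ?normr_ge0; lra.
have cy1 := cos_le1 y.
have c1 := @mul_cos_le_sin x ltac:(lra).
have s1 := sin_lex (ltW x0).
(* [1 / x] and [cos y / sin x] both lie between [cot x] and [1 / sin x]. *)
have key : 1 - cos x <= x * sin x.
  have ch : cos x = 1 - 2 * sin (x / 2) ^+ 2.
    by rewrite {1}[x]splitr -mulr2n cos_mulr2n cos2sin2 mulr2n; ring.
  have sh : sin x = 2 * sin (x / 2) * cos (x / 2).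
    by rewrite {1}[x]splitr -mulr2n sin_mulr2n mulr2n; ring.
  have sh0 : 0 <= sin (x / 2) by apply: sin_ge0_pi; lra.
  have shx : sin (x / 2) <= x / 2 by apply: sin_lex; lra.
  (* With this, [sin (x / 2) <= x / 2 <= x * cos (x / 2)]; multiplied by [2 * sin (x / 2)] it is the
     claim. *)
  have chh : 1 / 2 <= cos (x / 2).
    have ch0 : 0 <= cos (x / 2) by apply: cos_ge0_pihalf; lra.
    have cc : 0 <= cos x by apply: cos_ge0_pihalf; lra.
    have := cos2Dsin2 (x / 2).
    by nra.
  rewrite ch sh; nra.
have ix : 0 < x^-1 by rewrite invr_gt0.
have isx : 0 < (sin x)^-1 by rewrite invr_gt0.
have e1 : cos x / sin x <= x^-1.
  by rewrite ler_pdivrMr // mulrC ler_pdivlMr // mulrC.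
have e2 : x^-1 <= (sin x)^-1 by rewrite lef_pV2.
have e3 : (sin x)^-1 - cos x / sin x <= x.
  by rewrite -{1}[(sin x)^-1]mul1r -mulrBl ler_pdivrMr.
have e4 : cos x / sin x <= cos y / sin x by rewrite ler_wpM2r // ltW.
have e5 : cos y / sin x <= (sin x)^-1 by rewrite ler_piMl // ltW.
by rewrite ler_norml; apply/andP; split; lra.
Qed.

(** Multiplied by [2 * sin x], with [x] half the angular step, the sum telescopes on each side of
    the single sign change. The outer boundary terms cancel because a shift by [pi] negates the
    cosine, which leaves [cos y / sin x] with [|y| <= x]. *)
Lemma sum_abs_sin n th : (0 < n)%N -> 0 <= th < pi ->
  `|\sum_(k < n) `|sin (pi * k%:R / n%:R - th)| - 2 * n%:R / pi| <= 2 / n%:R.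
Proof.
move=> n0 /andP[th0 thpi]; have pi0 := @pi_gt0 R.
have n0R : 0 < n%:R :> R by rewrite ltr0n.
pose x : R := pi / n%:R / 2.
have nx : n%:R * x = pi / 2 by rewrite /x; field; rewrite gt_eqF.
have x0 : 0 < x by rewrite /x !divr_gt0.
have n1 : 1 <= n%:R :> R by rewrite ler1n.
have xpi : x <= pi / 2 by rewrite -nx ler_peMl // ltW.
have sx0 : 0 < sin x by apply: sin_gt0_pi; lra.
(* [j] is the last direction not beyond [th]: the sines are nonpositive up to [j] and nonnegative
   after it. *)
pose j := Num.truncn (th / (2 * x)).
have thx0 : 0 <= th / (2 * x) by rewrite divr_ge0 //; lra.
have /andP[j1 j2] := truncn_itv thx0; rewrite -/j in j1 j2.
have {}j1 : j%:R * (2 * x) <= th by move: j1; rewrite ler_pdivlMr //; lra.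
have {}j2 : th < j.+1%:R * (2 * x) by move: j2; rewrite ltr_pdivrMr //; lra.
have jn : (j.+1 <= n)%N.
  by rewrite -(ltr_nat R) -(ltr_pM2r (x := 2 * x)); lra.
have term k : pi * k%:R / n%:R - th = k%:R * (2 * x) - th.
  by rewrite /x; field; rewrite gt_eqF.
pose F (k : nat) : R := cos (k%:R * (2 * x) - x - th).
have tele k : 2 * sin x * sin (k%:R * (2 * x) - th) = F k - F k.+1.
  rewrite /F -[k.+1%:R]natr1.
  have -> : k%:R * (2 * x) - x - th = (k%:R * (2 * x) - th) - x by ring.
  have -> : (k%:R + 1) * (2 * x) - x - th = (k%:R * (2 * x) - th) + x by ring.
  by move: (_ - th) => z; rewrite cosB cosD; ring.
have Fn : F n = - F 0%N.
  rewrite /F.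
  have -> : n%:R * (2 * x) - x - th = (0%:R * (2 * x) - x - th) + pi by lra.
  by rewrite cosDpi.
have S : 2 * sin x * \sum_(k < n) `|sin (pi * k%:R / n%:R - th)| = 2 * F j.+1.
  rewrite -(big_mkord xpredT (fun k => `|sin (pi * k%:R / n%:R - th)|)) /=.
  rewrite (@big_cat_nat _ _ _ j.+1) //= mulrDr.
  have -> : 2 * sin x * \sum_(0 <= k < j.+1) `|sin (pi * k%:R / n%:R - th)| = F j.+1 - F 0%N.
    rewrite -telescope_sumr // mulr_sumr; apply: eq_big_nat => k /andP[_ kj].
    have kj' : k%:R <= j%:R :> R by rewrite ler_nat -ltnS.
    have kjx : k%:R * (2 * x) <= j%:R * (2 * x) by rewrite ler_pM2r //; lra.
    have k0x : 0 <= k%:R * (2 * x) by rewrite mulr_ge0 //; lra.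
    rewrite term -normrN -sinN ger0_norm; last by apply: sin_ge0_pi; lra.
    by rewrite sinN mulrN tele opprB.
  have -> : 2 * sin x * \sum_(j.+1 <= k < n) `|sin (pi * k%:R / n%:R - th)| = - (F n - F j.+1).
    rewrite -telescope_sumr // -sumrN mulr_sumr; apply: eq_big_nat => k /andP[jk kn].
    have kj' : j.+1%:R <= k%:R :> R by rewrite ler_nat.
    have kn' : k%:R <= n%:R :> R by rewrite ler_nat ltnW.
    have kjx : j.+1%:R * (2 * x) <= k%:R * (2 * x) by rewrite ler_pM2r //; lra.
    have knx : k%:R * (2 * x) <= n%:R * (2 * x) by rewrite ler_pM2r //; lra.
    rewrite term ger0_norm; last by apply: sin_ge0_pi; lra.
    by rewrite tele opprB.
  by rewrite Fn; ring.
have -> : \sum_(k < n) `|sin (pi * k%:R / n%:R - th)| = F j.+1 / sin x.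
  by apply: (mulfI (lt0r_neq0 (mulr_gt0 (ltr0Sn R 1) sx0))); rewrite S; field; rewrite gt_eqF.
have aux (p q : R) : p != 0 -> q != 0 -> 2 * q / p = (p / q / 2)^-1.
  by move=> p0 q0; field; rewrite ?p0 ?q0.
rewrite aux ?gt_eqF // -/x.
apply: (@le_trans _ _ x).
  apply: inv_sin_bounds; first by rewrite x0.
  by rewrite ler_norml; move: j2; rewrite -[j.+1%:R]natr1 => j2; apply/andP; split; lra.
rewrite ler_pdivlMr // mulrC nx; have := @pihalf_lt2 R; lra.
Qed.

End Trig.

(** * Lines and segments in rotated coordinates *)

Section Lines.
Variable R : realType.
Implicit Types (th p q t s : R) (x y : pt R).

(* The point of [line th p] with arc length parameter [t], as in [chord]. *)
Definition pnt th p t : pt R := (p * cos th - t * sin th, p * sin th + t * cos th).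

(** [nproj] and [tproj] are the normal and the tangential coordinate with respect to [th]; together
    they invert [pnt]. *)
Definition nproj th x : R := x.1 * cos th + x.2 * sin th.

Definition tproj th x : R := x.2 * cos th - x.1 * sin th.

Lemma pntK th x : pnt th (nproj th x) (tproj th x) = x.
Proof.
case: x => x y; rewrite /pnt /nproj /tproj /=.
have h := cos2Dsin2 th; congr (_, _).
  by rewrite -[RHS]mulr1 -h; ring.
by rewrite -[RHS]mulr1 -h; ring.
Qed.

Lemma nproj_pnt th th' p t :
  nproj th' (pnt th p t) = p * cos (th' - th) + t * sin (th' - th).
Proof. by rewrite cosB sinB /nproj /pnt /=; ring. Qed.

Lemma nproj_pnt_id th p t : nproj th (pnt th p t) = p.
Proof. by rewrite nproj_pnt subrr cos0 sin0; ring. Qed.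

Lemma pnt_inj th p t t' : pnt th p t = pnt th p t' -> t = t'.
Proof.
case=> h1 h2; have h := cos2Dsin2 th.
have c1 : (t - t') * sin th = 0 by lra.
have c2 : (t - t') * cos th = 0 by lra.
apply/eqP; rewrite -subr_eq0; apply/eqP.
rewrite -[LHS]mulr1 -h.
have -> : (t - t') * (cos th ^+ 2 + sin th ^+ 2) =
  (t - t') * cos th * cos th + (t - t') * sin th * sin th by ring.
by rewrite c1 c2; ring.
Qed.

Definition pseg th p t0 t1 : segment R := (pnt th p t0, pnt th p t1).

Lemma pseg_ptsP th p t0 t1 x : t0 <= t1 ->
  seg_pts (pseg th p t0 t1) x <-> exists2 t, t0 <= t <= t1 & x = pnt th p t.
Proof.
move=> t01; split=> [[u /andP[u0 u1] ->]|[t /andP[tl tr] ->]].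
  exists ((1 - u) * t0 + u * t1); first by apply/andP; split; nra.
  by rewrite /pnt /=; congr (_, _); ring.
move: t01; rewrite le_eqVlt => /predU1P[tt|t01].
  have -> : t = t0 by lra.
  exists 0; first by rewrite lexx ler01.
  by rewrite /pnt /=; congr (_, _); ring.
exists ((t - t0) / (t1 - t0)).
  rewrite divr_ge0 ?ler_pdivrMr; lra.
have ne : t1 - t0 != 0 by rewrite gt_eqF //; lra.
have E : (1 - (t - t0) / (t1 - t0)) * t0 + (t - t0) / (t1 - t0) * t1 = t by field.
by move: E; set u := (t - t0) / _ => <-; rewrite /pnt /=; congr (_, _); ring.
Qed.

Lemma pseg_sub_line th p t0 t1 : seg_pts (pseg th p t0 t1) `<=` line th p.
Proof.
move=> x [u _ ->]; rewrite /line /=.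
by rewrite -[RHS](mulr1 p) -[X in _ = _ * X](cos2Dsin2 th); ring.
Qed.

Lemma seg_len_pseg th p t0 t1 : t0 <= t1 -> seg_len (pseg th p t0 t1) = t1 - t0.
Proof.
move=> t01; rewrite /seg_len /pseg /pnt /=.
have -> : (p * cos th - t1 * sin th - (p * cos th - t0 * sin th)) ^+ 2 +
  (p * sin th + t1 * cos th - (p * sin th + t0 * cos th)) ^+ 2 = (t1 - t0) ^+ 2.
  by rewrite -[RHS]mulr1 -(cos2Dsin2 th); ring.
by rewrite sqrtr_sqr ger0_norm // subr_ge0.
Qed.

Lemma lines_meet_once th p th' p' x y : sin (th - th') != 0 ->
  line th p x -> line th' p' x -> line th p y -> line th' p' y -> x = y.
Proof.
rewrite sinB /line /= => s0 hx hx' hy hy'.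
case: x y hx hx' hy hy' => [x1 x2] [y1 y2] /= hx hx' hy hy'.
have d1 : (x1 - y1) * (sin th * cos th' - cos th * sin th') = 0.
  have -> : (x1 - y1) * (sin th * cos th' - cos th * sin th') =
    (x1 * cos th' + x2 * sin th' - (y1 * cos th' + y2 * sin th')) * sin th -
    (x1 * cos th + x2 * sin th - (y1 * cos th + y2 * sin th)) * sin th' by ring.
  by rewrite hx hx' hy hy'; ring.
have d2 : (x2 - y2) * (sin th * cos th' - cos th * sin th') = 0.
  have -> : (x2 - y2) * (sin th * cos th' - cos th * sin th') =
    (x1 * cos th + x2 * sin th - (y1 * cos th + y2 * sin th)) * cos th' -
    (x1 * cos th' + x2 * sin th' - (y1 * cos th' + y2 * sin th')) * cos th by ring.
  by rewrite hx hx' hy hy'; ring.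
move/eqP: d1; rewrite mulf_eq0 (negPf s0) orbF subr_eq0 => /eqP ->.
by move/eqP: d2; rewrite mulf_eq0 (negPf s0) orbF subr_eq0 => /eqP ->.
Qed.

(* A segment of [line th p] is coded by the tuple [(th, p, t0, t1)]. *)
Definition mkseg (z : R * R * R * R) : segment R := pseg z.1.1.1 z.1.1.2 z.1.2 z.2.

(** For angles in [0, pi), different pairs of angle and offset give different lines, and two of
    these are disjoint or meet in one point. *)
Lemma non_overlapping_mkseg (Q : seq (R * R * R * R)) :
  uniq [seq z.1.1 | z <- Q] -> (forall z, z \in Q -> 0 <= z.1.1.1 < pi) ->
  non_overlapping [seq mkseg z | z <- Q].
Proof.
move=> uQ Qpi i j; rewrite size_map => iQ jQ ij x y [xi xj] [yi yj].
set z0 : R * R * R * R := (0, 0, 0, 0).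
move: xi xj yi yj; rewrite !(nth_map z0) // /mkseg => xi xj yi yj.
have zij : (nth z0 Q i).1.1 != (nth z0 Q j).1.1.
  have := nth_uniq z0.1.1 (s := [seq z.1.1 | z <- Q]).
  rewrite size_map => /(_ i j iQ jQ uQ); rewrite !(nth_map z0) // => ->.
  exact/eqP.
have := Qpi _ (mem_nth z0 iQ); have := Qpi _ (mem_nth z0 jQ).
move: zij {Qpi} xi xj yi yj; move: (nth z0 Q i) (nth z0 Q j).
move=> [[[th p] t0] t1] [[[th' p'] t0'] t1'] /= ne.
move=> /pseg_sub_line xi /pseg_sub_line xj /pseg_sub_line yi /pseg_sub_line yj h1 h2.
have [E|ths] := eqVneq th th'.
  move: ne; rewrite E xpair_eqE eqxx /= => /eqP; case.
  by rewrite -[p]xi -[p']xj E.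
apply: (lines_meet_once _ xi xj yi yj).
have := sin_gt0_pi (x := th - th'); have := sin_gt0_pi (x := th' - th).
rewrite -opprB sinN => s1 s2; case: (ltgtP th th') ths => // lt _.
  by rewrite lt_eqF // -oppr_gt0 s1 //; lra.
by rewrite gt_eqF // s2 //; lra.
Qed.

End Lines.

(** * Sections of the body and crossings of its chords *)

Section ConvexBody.
Variables (R : realType) (Om : set (pt R)).
Hypothesis bOm : convex_body Om.
Implicit Types (th p q t s : R) (x y : pt R).

Lemma convex_body_closed : closed Om.
Proof. by case: bOm => cOm _; apply: compact_closed => //; exact: norm_hausdorff. Qed.

Lemma convex_body_bounded :
  exists2 D : R, 1 <= D & forall x, Om x -> `|x.1| <= D /\ `|x.2| <= D.
Proof.
have [/compact_bounded[M [_ M2]] _] := bOm.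
exists (`|M| + 1) => [|x Omx]; first by rewrite lerDr.
have M1 : M < `|M| + 1 by rewrite (le_lt_trans (ler_norm M)) ?ltrDl.
by have := M2 _ M1 x Omx; rewrite /= prod_normE /= ge_max => /andP[].
Qed.

Lemma convex_body_square :
  exists (c : pt R) (r : R), 0 < r /\
    forall x, `|x.1 - c.1| <= r -> `|x.2 - c.2| <= r -> Om x.
Proof.
have [_ [_ [c /= /nbhs_ballP[e /= e0 H]]]] := bOm.
exists c, (e / 2); split; first by rewrite divr_gt0.
move=> x x1 x2; apply: H; rewrite /ball /= /prod_ball /= /ball /=.
by rewrite -normrN opprB -[X in _ /\ X < _]normrN opprB; split; lra.
Qed.

Lemma convex_body_pnt th p s q t u : Om (pnt th p s) -> Om (pnt th q t) ->
  0 <= u <= 1 -> Om (pnt th ((1 - u) * p + u * q) ((1 - u) * s + u * t)).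
Proof.
have [_ [cOm _]] := bOm => Ox Oy u01.
have := cOm _ _ Ox Oy u u01; rewrite /pnt /=; congr (Om (_, _)); ring.
Qed.

Definition hits th p : Prop := exists t, Om (pnt th p t).
(** For an empty section both [slo] and [shi] are 0, so [shi - slo] is the chord length for every
    line. *)
Definition slo th p : R := inf [set t | Om (pnt th p t)].
Definition shi th p : R := sup [set t | Om (pnt th p t)].

Lemma section_interval th p : hits th p ->
  slo th p <= shi th p /\
  [set t | Om (pnt th p t)] = `[slo th p, shi th p]%classic.
Proof.
move=> [t0 Ot0]; rewrite /slo /shi; set A := [set t | _].
have [D _ OD] := convex_body_bounded.
have bA t : A t -> t \in `[- (`|sin th| * D + `|cos th| * D), `|sin th| * D + `|cos th| * D].
  move=> At; have [h1 h2] := OD _ At.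
  rewrite in_itv /= -ler_norml.
  have -> : t = tproj th (pnt th p t).
    apply: (@pnt_inj _ th p).
    by rewrite -{1}(pntK th (pnt th p t)) nproj_pnt_id.
  rewrite /tproj (le_trans (ler_normB _ _)) // addrC !normrM.
  by rewrite lerD // mulrC ler_wpM2l.
have cpnt : continuous (pnt th p : R -> R * R).
  move=> t.
  have c1 : (fun t : R => p * cos th - t * sin th) @ t --> p * cos th - t * sin th.
    by apply: cvgB; [exact: cvg_cst|apply: cvgMl; exact: cvg_id].
  have c2 : (fun t : R => p * sin th + t * cos th) @ t --> p * sin th + t * cos th.
    by apply: cvgD; [exact: cvg_cst|apply: cvgMl; exact: cvg_id].
  exact: (cvg_pair c1 c2).
have clA : closed A := (continuous_closedP _).1 cpnt _ convex_body_closed.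
have cA : compact A.
  set M := `|sin th| * D + `|cos th| * D in bA.
  by apply: (subclosed_compact clA (segment_compact (a := - M) (b := M))) => t /bA.
have A0 : A !=set0 by exists t0.
have cid' : {within A, continuous (@idfun R)}.
  by apply: continuous_subspaceT => t; exact: cvg_id.
have [a aA amin] := compact_EVT_min A0 cA cid'.
have [b bA' bmax] := compact_EVT_max A0 cA cid'.
have {}aA : A a by rewrite inE in aA.
have {}bA' : A b by rewrite inE in bA'.
have ab : a <= b by apply: amin; rewrite inE.
have E : A = `[a, b]%classic.
  apply/seteqP; split => t /=; rewrite in_itv /=.
    by move=> At; apply/andP; split; [apply: amin|apply: bmax]; rewrite inE.
  move=> /andP[at_ tb]; move: ab; rewrite le_eqVlt => /predU1P[ab|ab].
    by have -> : t = a by lra.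
  have u01 : 0 <= (t - a) / (b - a) <= 1.
    by rewrite divr_ge0 ?ler_pdivrMr; lra.
  have := convex_body_pnt aA bA' u01.
  rewrite /A /=; congr (Om (pnt _ _ _)); field; rewrite gt_eqF //; lra.
by rewrite E inf_itvcc // sup_itvcc.
Qed.

Lemma sectionP th p t : hits th p -> Om (pnt th p t) <-> slo th p <= t <= shi th p.
Proof.
move=> /section_interval[_ E]; move/seteqP: E => [E1 E2].
by split=> [/E1|h]; [|apply: E2]; rewrite /= in_itv.
Qed.

Lemma slo_le_shi th p : slo th p <= shi th p.
Proof.
have [/section_interval[]//|nh] := pselect (hits th p).
have -> : slo th p = 0.
  by rewrite /slo (_ : [set t | _] = set0) ?inf0 // -subset0 => t ?; apply: nh; exists t.
by rewrite /shi (_ : [set t | _] = set0) ?sup0 // -subset0 => t ?; apply: nh; exists t.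
Qed.

Lemma lebesgue_section th p :
  lebesgue_measure [set t | Om (pnt th p t)] = (shi th p - slo th p)%:E.
Proof.
have [h|nh] := pselect (hits th p).
  have [_ E] := section_interval h; rewrite E lebesgue_measure_itv /= lte_fin.
  have := slo_le_shi th p; rewrite le_eqVlt => /predU1P[->|->]; last by rewrite EFinB.
  by rewrite ltxx subrr.
have E : [set t | Om (pnt th p t)] = set0.
  by rewrite -subset0 => t ?; apply: nh; exists t.
by rewrite /slo /shi E measure0 inf0 sup0 subrr.
Qed.

Lemma chordE th p : chord Om th p = shi th p - slo th p.
Proof. by rewrite /chord [X in fine X]lebesgue_section. Qed.

Lemma chord_le D th p : (forall x, Om x -> `|x.1| <= D /\ `|x.2| <= D) ->
  0 <= D -> chord Om th p <= 4 * D.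
Proof.
move=> OD D0; rewrite chordE.
have [h|nh] := pselect (hits th p); last first.
  rewrite /slo /shi (_ : [set t | _] = set0) ?inf0 ?sup0; first by lra.
  by rewrite -subset0 => t ?; apply: nh; exists t.
have b t : Om (pnt th p t) -> `|t| <= 2 * D.
  move=> /OD[h1 h2]; have -> : t = tproj th (pnt th p t).
    by apply: (@pnt_inj _ th p); rewrite -{1}(pntK th (pnt th p t)) nproj_pnt_id.
  rewrite /tproj (le_trans (ler_normB _ _)) // !normrM mulr2n mulrDl !mul1r.
  by rewrite lerD // -[leRHS]mulr1 ler_pM // ?cos_max ?sin_max.
have /b/ler_normlP[h1 _] : Om (pnt th p (slo th p)).
  by apply/sectionP => //; rewrite lexx slo_le_shi.
have /b/ler_normlP[_ h2] : Om (pnt th p (shi th p)).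
  by apply/sectionP => //; rewrite lexx slo_le_shi.
lra.
Qed.

Lemma hits_bounded D th p : (forall x, Om x -> `|x.1| <= D /\ `|x.2| <= D) ->
  hits th p -> `|p| <= 2 * D.
Proof.
move=> OD [t /OD[h1 h2]]; rewrite -(nproj_pnt_id th p t) /nproj.
rewrite (le_trans (ler_normD _ _)) // !normrM mulr2n mulrDl !mul1r.
by rewrite lerD // -[leRHS]mulr1 ler_pM // ?cos_max ?sin_max.
Qed.

Lemma cross_count_le1 (s : segment R) th p : 0 <= cross_count s th p <= 1.
Proof. by rewrite /cross_count; case: ifP => _; rewrite ?lexx ?ler01. Qed.

Lemma cross_count_miss (s : segment R) th p : seg_pts s `<=` Om -> ~ hits th p ->
  cross_count s th p = 0.
Proof.
move=> sOm nh; rewrite /cross_count; case: asboolP => // -[[x [xs xl]] _].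
by case: nh; exists (tproj th x); rewrite -xl pntK; exact: sOm.
Qed.

(** The shadow, on the normal with angle [ph], of the chord cut by [line th q]: for a line that hits
    the body, the offsets [p] for which [line ph p] meets this chord. *)
Definition crossing_lo th q ph : R :=
  Num.min (nproj ph (pnt th q (slo th q))) (nproj ph (pnt th q (shi th q))).
Definition crossing_hi th q ph : R :=
  Num.max (nproj ph (pnt th q (slo th q))) (nproj ph (pnt th q (shi th q))).

Lemma crossing_width th q ph :
  crossing_hi th q ph - crossing_lo th q ph = chord Om th q * `|sin (ph - th)|.
Proof.
rewrite /crossing_hi /crossing_lo chordE -(ger0_norm (x := shi th q - slo th q)); last first.
  by rewrite subr_ge0 slo_le_shi.
rewrite -normrM !nproj_pnt.
set a := q * _ + slo th q * _; set b := q * _ + shi th q * _.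
have -> : (shi th q - slo th q) * sin (ph - th) = b - a by rewrite /a /b; ring.
case: (leP a b) => ab; first by rewrite ger0_norm // subr_ge0.
by rewrite ltr0_norm ?opprB // subr_lt0.
Qed.

Lemma cross_count_le th q ph p t0 t1 : hits th q ->
  t0 <= t1 -> seg_pts (pseg ph p t0 t1) `<=` Om ->
  cross_count (pseg ph p t0 t1) th q
    <= (crossing_lo th q ph <= p <= crossing_hi th q ph)%R%:R.
Proof.
move=> h t01 sOm; rewrite /cross_count; case: asboolP => // -[[x [xs xl]] _].
suff -> : crossing_lo th q ph <= p <= crossing_hi th q ph by [].
have xp := pseg_sub_line xs.
have Ox := sOm _ xs.
rewrite -(pntK th x) [nproj th x]xl in Ox.
have /andP[t1' t2'] := (sectionP _ h).1 Ox.
have -> : p = nproj ph (pnt th q (tproj th x)).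
  by rewrite -[X in pnt th X]xl pntK [RHS]xp.
rewrite /crossing_lo /crossing_hi !nproj_pnt ge_min le_max !lerD2l.
have [s0|s0] := leP 0 (sin (ph - th)); apply/andP; split; apply/orP.
- by left; rewrite ler_wpM2r.
- by right; rewrite ler_wpM2r.
- by right; rewrite ler_wnM2r // ltW.
- by left; rewrite ler_wnM2r // ltW.
Qed.

(** A segment through the centre [c] of an inscribed square, parallel to the line and of half length
    [r], is contracted towards [x] or [y] until it lies on the line. The factor [1 - u] stays
    positive because [p] is strictly between the two offsets. *)
Lemma interior_section ph p x y : Om x -> Om y -> nproj ph x < p < nproj ph y ->
  slo ph p < shi ph p.
Proof.
move=> Ox Oy /andP[xp py].
have [c [r [r0 Oc]]] := convex_body_square.
have Oc' s : `|s| <= r -> Om (pnt ph (nproj ph c) (tproj ph c + s)).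
  move=> sr.
  have E : pnt ph (nproj ph c) (tproj ph c + s) = (c.1 - s * sin ph, c.2 + s * cos ph).
    have h1 := congr1 fst (pntK ph c); have h2 := congr1 snd (pntK ph c).
    by rewrite /= in h1 h2; rewrite /pnt; congr (_, _); [rewrite -h1|rewrite -h2]; ring.
  rewrite E; apply: Oc => /=.
    rewrite addrAC subrr sub0r normrN normrM (le_trans _ sr) //.
    by rewrite ler_piMr ?sin_max.
  rewrite addrAC subrr add0r normrM (le_trans _ sr) //.
  by rewrite ler_piMr ?cos_max.
set p0 := nproj ph c in Oc'; set s0 := tproj ph c in Oc'.
suff [u [z [u01 Oz E]]] : exists u z, [/\ 0 <= u < 1, Om z & p = (1 - u) * p0 + u * nproj ph z].
  have /andP[u0 u1] := u01; have u01' : 0 <= u <= 1 by rewrite u0 ltW.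
  rewrite -(pntK ph z) in Oz.
  have rr : `|r| <= r by rewrite ger0_norm // ltW.
  have Nrr : `|- r| <= r by rewrite normrN.
  have := convex_body_pnt (Oc' _ Nrr) Oz u01'; have := convex_body_pnt (Oc' _ rr) Oz u01'.
  rewrite -E => O1 O2.
  have h : hits ph p by eexists; exact: O1.
  have /andP[_ A] := (sectionP _ h).1 O1; have /andP[B _] := (sectionP _ h).1 O2.
  apply: (le_lt_trans B); apply: lt_le_trans A.
  by rewrite ltrD2r ltr_pM2l; lra.
have [pp|pp] := leP p0 p.
  exists ((p - p0) / (nproj ph y - p0)), y; split=> //.
    by rewrite divr_ge0 ?ltr_pdivrMr; lra.
  by field; rewrite gt_eqF //; lra.
exists ((p0 - p) / (p0 - nproj ph x)), x; split=> //.
  by rewrite divr_ge0 ?ltr_pdivrMr; lra.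
by field; rewrite gt_eqF //; lra.
Qed.

(** The lower counterpart of [cross_count_le], for the open shadow. A chord reduced to a point would
    lie inside [line th q] and count 0, so [interior_section] is called upon. *)
Lemma cross_count_eq1 th q ph p : hits th q ->
  crossing_lo th q ph < p < crossing_hi th q ph ->
  hits ph p /\ cross_count (pseg ph p (slo ph p) (shi ph p)) th q = 1.
Proof.
move=> h; have Oa : Om (pnt th q (slo th q)) by apply/sectionP; rewrite ?lexx ?slo_le_shi.
have Ob : Om (pnt th q (shi th q)) by apply/sectionP; rewrite ?lexx ?slo_le_shi.
rewrite /crossing_lo /crossing_hi.
set a := nproj ph (pnt th q (slo th q)); set b := nproj ph (pnt th q (shi th q)) => pab.
have lt : slo ph p < shi ph p.
  case: (leP a b) pab => ab pab.
    exact: interior_section Oa Ob pab.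
  exact: interior_section Ob Oa pab.
have ba : b - a = (shi th q - slo th q) * sin (ph - th) by rewrite /a /b !nproj_pnt; ring.
have ab : b - a != 0.
  rewrite subr_eq0; apply: contraTneq pab => ->; rewrite minxx maxxx.
  by apply/negP => /andP[h1 h2]; move: (lt_trans h1 h2); rewrite ltxx.
have s0 : sin (ph - th) != 0 by move: ab; rewrite ba mulf_eq0 negb_or => /andP[].
pose u := (p - a) / (b - a).
have u01 : 0 <= u <= 1.
  rewrite /u; case: (ltgtP a b) pab => // ab' /andP[h1 h2].
  - by rewrite divr_ge0 ?ler_pdivrMr; lra.
  - by rewrite -[_ / _]mulrNN -invrN !opprB divr_ge0 ?ler_pdivrMr; lra.
  - by move: ab; rewrite ab' subrr eqxx.
have := convex_body_pnt Oa Ob u01.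
have -> : (1 - u) * q + u * q = q by ring.
set t := _ + _ => Ox.
have xp : nproj ph (pnt th q t) = p.
  transitivity (a + u * (b - a)); last by rewrite /u; field.
  by rewrite ba /a !nproj_pnt /t; ring.
have hp : hits ph p.
  by exists (tproj ph (pnt th q t)); rewrite -{1}xp pntK.
split=> //; rewrite /cross_count asboolT //; split.
  exists (pnt th q t); split; last exact: nproj_pnt_id.
  apply/pseg_ptsP; first exact: ltW.
  exists (tproj ph (pnt th q t)); last by rewrite -[in RHS]xp pntK.
  by apply/sectionP => //; rewrite -{1}xp pntK.
move=> sub.
have on s : slo ph p <= s <= shi ph p -> nproj th (pnt ph p s) = q.
  by move=> hs; apply: sub; apply/pseg_ptsP; [exact: ltW|exists s].
have := on (slo ph p); have := on (shi ph p); rewrite !lexx !ltW // => /(_ isT) e1 /(_ isT) e2.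
have : (shi ph p - slo ph p) * sin (th - ph) = 0.
  move: e1 e2; rewrite !nproj_pnt => e1 e2.
  by transitivity (q - q); [rewrite -{1}e1 -e2; ring|rewrite subrr].
move/eqP; rewrite mulf_eq0 subr_eq0 gt_eqF //= -opprB sinN oppr_eq0.
by rewrite (negPf s0).
Qed.

End ConvexBody.

(** * Area, and the total length of the chords along a lattice *)

Section Area.
Variable R : realType.

(** The complement is the countable union of the squares it contains whose corners lie on the grids
    of mesh [1 / (m + 1)]; such squares are rectangles of the product sigma-algebra. *)
Lemma closed_measurable_prod (A : set (R * R)) : closed A ->
  measurable (A : set (measurableTypeR R * measurableTypeR R)%type).
Proof.
move=> clA; rewrite -[A]setCK; apply: measurableC.
have oA : open (~` A) by exact: closed_openC.
pose bx (z : int * int * nat) : set (R * R) :=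
  `[z.1.1%:~R / z.2.+1%:R, (z.1.1%:~R + 1) / z.2.+1%:R]%classic `*`
  `[z.1.2%:~R / z.2.+1%:R, (z.1.2%:~R + 1) / z.2.+1%:R]%classic.
pose F z := if asbool (bx z `<=` ~` A) then bx z else set0.
have -> : ~` A = \bigcup_z F z.
  apply/seteqP; split => [x Ax|x [z _]]; last first.
    by rewrite /F; case: asboolP => // h; exact: h.
  have /nbhs_ballP[e /= e0 H] := open_nbhs_nbhs (conj oA Ax).
  pose n := Num.truncn e^-1.
  have n0 : 0 < n.+1%:R :> R by rewrite ltr0n.
  have ne : n.+1%:R^-1 < e.
    have e1 : 0 <= e^-1 by rewrite invr_ge0 ltW.
    have /andP[_ h] := truncn_itv e1.
    by rewrite -[e]invrK ltf_pV2 ?posrE ?invr_gt0.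
  have fl (u : R) : (Num.floor (u * n.+1%:R))%:~R / n.+1%:R <= u <=
      ((Num.floor (u * n.+1%:R))%:~R + 1) / n.+1%:R.
    have /andP[h1 h2] := floor_itv (u * n.+1%:R).
    by rewrite ler_pdivrMr // ler_pdivlMr // h1 ltW // -intrD1.
  exists (Num.floor (x.1 * n.+1%:R), Num.floor (x.2 * n.+1%:R), n) => //.
  have /andP[a1 a2] := fl x.1; have /andP[b1 b2] := fl x.2.
  rewrite /F asboolT; first by split; rewrite /= in_itv /= ?a1 ?a2 ?b1 ?b2.
  move=> y [] /=; rewrite !in_itv /= => /andP[c1 c2] /andP[d1 d2].
  apply: H; rewrite /ball /= /prod_ball /= /ball /=.
  move: a1 a2 b1 b2 c1 c2 d1 d2 ne; rewrite !mulrDl !mul1r.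
  move: (_ / n.+1%:R) => u; move: (_ / n.+1%:R) => v; move: (n.+1%:R^-1) => w *.
  by rewrite !ltr_norml; split; apply/andP; split; lra.
apply: countable_bigcupT_measurable => // z.
rewrite /F; case: ifP => _; last exact: measurable0.
by apply: measurableX; exact: measurable_itv.
Qed.

Lemma lebesgue_measure_itvcc (a b : R) : a <= b ->
  lebesgue_measure (`[a, b]%classic : set R) = (b - a)%:E.
Proof.
rewrite lebesgue_measure_itv /= lte_fin le_eqVlt => /predU1P[->|->].
  by rewrite ltxx subrr.
by rewrite EFinB.
Qed.

Variable Om : set (pt R).
Hypothesis bOm : convex_body Om.
Implicit Types (th ph p q d D : R).

Lemma measurable_convex_body :
  measurable (Om : set (measurableTypeR R * measurableTypeR R)%type).
Proof. by apply: closed_measurable_prod; exact: convex_body_closed. Qed.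

(** Cavalieri's principle for the vertical lines ([ph = 0]) and the horizontal ones
    ([ph = pi / 2]). *)
Lemma leb2_sections ph : ph = 0 \/ ph = pi / 2 ->
  measurable_fun setT (fun x : measurableTypeR R => (shi Om ph x - slo Om ph x)%:E) /\
  leb2 Om = (\int[lebesgue_measure]_x (shi Om ph x - slo Om ph x)%:E)%E.
Proof.
have mOm := measurable_convex_body.
case=> ->.
  have E : (fun x : measurableTypeR R => (shi Om 0 x - slo Om 0 x)%:E) =
      lebesgue_measure \o xsection Om.
    apply/funext => x /=; rewrite -lebesgue_section //; congr (lebesgue_measure _).
    by rewrite /pnt cos0 sin0; apply/seteqP; split => t /=;
      rewrite /xsection /= inE !mulr0 !mulr1 subr0 add0r.
  by rewrite E; split => //; exact: measurable_fun_xsection.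
have E : (fun x : measurableTypeR R => (shi Om (pi / 2) x - slo Om (pi / 2) x)%:E) =
    lebesgue_measure \o ysection Om.
  apply/funext => y /=; have [h|nh] := pselect (hits Om (pi / 2) y).
    (* The interval is reflected because [pnt (pi / 2) y t] is [(- t, y)]. *)
    have -> : ysection Om y = `[- shi Om (pi / 2) y, - slo Om (pi / 2) y]%classic.
      apply/seteqP; split => x /=; rewrite /ysection /= inE in_itv /= => H.
        have : Om (pnt (pi / 2) y (- x)).
          by rewrite /pnt cos_pihalf sin_pihalf !mulr0 !mulr1 sub0r opprK addr0.
        by move=> /(sectionP bOm _ h); rewrite lerNr lerNl andbC.
      rewrite andbC lerNl lerNr in H.
      have /(sectionP bOm _ h) : slo Om (pi / 2) y <= - x <= shi Om (pi / 2) y.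
        by move: H => /andP[? ?]; apply/andP; split; lra.
      by rewrite /pnt cos_pihalf sin_pihalf !mulr0 !mulr1 sub0r opprK addr0.
    have ss := slo_le_shi bOm (pi / 2) y.
    by rewrite lebesgue_measure_itvcc; [congr EFin; ring|lra].
  rewrite -lebesgue_section //.
  have -> : [set t | Om (pnt (pi / 2) y t)] = set0.
    by rewrite -subset0 => t ?; apply: nh; exists t.
  have -> : ysection Om y = set0; last by rewrite !measure0.
  rewrite -subset0 => x; rewrite /ysection /= inE => H; apply: nh; exists (- x).
  by rewrite /pnt cos_pihalf sin_pihalf !mulr0 !mulr1 sub0r opprK addr0.
rewrite E; split; first exact: measurable_fun_ysection.
transitivity (\int[lebesgue_measure]_x (lebesgue_measure \o xsection Om) x)%E => //.
rewrite -indic_fubini_tonelli_FE //.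
rewrite (indic_fubini_tonelli lebesgue_measure lebesgue_measure mOm).
by rewrite indic_fubini_tonelli_GE.
Qed.

Lemma leb2_gt0 : (0 < leb2 Om)%E.
Proof.
have [c [r [r0 Oc]]] := convex_body_square bOm.
pose K : set (measurableTypeR R * measurableTypeR R) :=
  `[c.1 - r, c.1 + r]%classic `*` `[c.2 - r, c.2 + r]%classic.
have KO : K `<=` Om.
  move=> x [] /=; rewrite !in_itv /= => /andP[? ?] /andP[? ?].
  by apply: Oc; rewrite ler_norml; apply/andP; split; lra.
have mK : measurable K by apply: measurableX; exact: measurable_itv.
have : (leb2 K <= leb2 Om)%E.
  by apply: le_measure; rewrite ?inE //; exact: measurable_convex_body.
have -> : leb2 K = ((c.1 + r - (c.1 - r)) * (c.2 + r - (c.2 - r)))%:E.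
  pose I1 : set R := `[c.1 - r, c.1 + r]%classic.
  pose I2 : set R := `[c.2 - r, c.2 + r]%classic.
  transitivity (@lebesgue_measure R I1 * @lebesgue_measure R I2)%E.
    by apply: product_measure1E; exact: measurable_itv.
  by rewrite /I1 /I2 !lebesgue_measure_itvcc ?EFinM //; lra.
by apply: lt_le_trans; rewrite lte_fin mulr_gt0; lra.
Qed.

(** The right-hand side is symmetric in the two lines. This lets the lattice offset and the
    integration variable exchange roles below. *)
Lemma meetP th q ph p : hits Om th q -> sin (ph - th) != 0 ->
  (crossing_lo Om th q ph <= p <= crossing_hi Om th q ph) <->
  exists x, [/\ Om x, nproj th x = q & nproj ph x = p].
Proof.
move=> h s0; pose F t := q * cos (ph - th) + t * sin (ph - th).
have FE t : nproj ph (pnt th q t) = F t by exact: nproj_pnt.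
have Fi t t' : (F t <= F t') = (if 0 < sin (ph - th) then t <= t' else t' <= t).
  rewrite lerD2l; case: ltP => s1; first by rewrite ler_pM2r.
  by rewrite ler_nM2r // lt_neqAle s0.
rewrite /crossing_lo /crossing_hi !FE.
have ll := slo_le_shi bOm th q.
pose t := (p - q * cos (ph - th)) / sin (ph - th).
have pt : p = F t by rewrite /F /t; field.
have E : (Num.min (F (slo Om th q)) (F (shi Om th q)) <= p <=
    Num.max (F (slo Om th q)) (F (shi Om th q))) = (slo Om th q <= t <= shi Om th q).
  rewrite pt; have [s1|s1] := ltP 0 (sin (ph - th)).
    rewrite min_l ?max_r ?Fi ?s1 //.
  by rewrite min_r ?max_l ?Fi ltNge ?s1 //= andbC.
rewrite E; split => [/(sectionP bOm _ h) Ot|[x [Ox xq xp]]].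
  by exists (pnt th q t); split => //; rewrite ?nproj_pnt_id // FE.
apply/(sectionP bOm _ h).
have -> : t = tproj th x; last by rewrite -xq pntK.
apply: (mulIf s0); apply: (addrI (q * cos (ph - th))); rewrite -/(F t) -pt.
by rewrite -/(F (tproj th x)) -FE -xp -xq pntK.
Qed.

(* Every line [line ph x] meets the lattice of parallel chords about
   [chord * |sin| / d] times, so that integrating over [x] compares the length of
   these chords with the area; this needs [line ph x] to be transverse to them,
   whence the two choices of [ph]. *)
Lemma lattice_length_transverse D ph th p d N :
  (forall x, Om x -> `|x.1| <= D /\ `|x.2| <= D) -> 0 <= D ->
  ph = 0 \/ ph = pi / 2 -> 1 / 2 <= `|sin (th - ph)| ->
  0 < d -> p - d < - (2 * D) -> 2 * D < p + N%:R * d ->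
  leb2 Om \is a fin_num /\
  `|\sum_(i < N) chord Om th (p + i%:R * d) - area Om / d| <= 8 * D.
Proof.
move=> OD D0 hph s12 d0 pl pr.
have [mg gE] := leb2_sections hph.
have s0 : sin (th - ph) != 0 by rewrite -normr_gt0; lra.
have s0' : sin (ph - th) != 0 by rewrite -opprB sinN oppr_eq0.
have sE : `|sin (ph - th)| = `|sin (th - ph)| by rewrite -opprB sinN normrN.
set s : R := `|sin (th - ph)| in s12 sE.
set g : measurableTypeR R -> R := fun x => shi Om ph x - slo Om ph x.
pose mu : {measure set (measurableTypeR R) -> \bar R} := @lebesgue_measure R.
(* The offsets [x] for which [line ph x] meets the [i]-th lattice chord. Their measure is [s] times
   that chord, so integrating the number of meetings over [x] gives [s] times the total length. *)
pose K (i : 'I_N) : set (measurableTypeR R) :=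
  [set x | hits Om th (p + i%:R * d) /\
    crossing_lo Om th (p + i%:R * d) ph <= x <= crossing_hi Om th (p + i%:R * d) ph].
pose J : set (measurableTypeR R) := `[- (2 * D), 2 * D]%classic.
have KE i : measurable (K i) /\ mu (K i) = (chord Om th (p + i%:R * d) * s)%:E.
  have [h|nh] := pselect (hits Om th (p + i%:R * d)).
    have -> : K i = `[crossing_lo Om th (p + i%:R * d) ph, crossing_hi Om th (p + i%:R * d) ph]%classic.
      by apply/seteqP; split => x /=; rewrite in_itv /= => // -[].
    split; first exact: measurable_itv.
    rewrite -sE -crossing_width //; apply: lebesgue_measure_itvcc.
    by rewrite /crossing_lo /crossing_hi ge_min !le_max lexx.
  have -> : K i = set0 by rewrite -subset0 => x [].
  split; first exact: measurable0.
  have -> : chord Om th (p + i%:R * d) = 0.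
    rewrite chordE // /slo /shi (_ : [set t | _] = set0) ?inf0 ?sup0 ?subrr //.
    by rewrite -subset0 => t ?; apply: nh; exists t.
  by rewrite measure0 mul0r.
have mJ : measurable J by exact: measurable_itv.
have muJ : mu J = (4 * D)%:E.
  have -> : 4 * D = 2 * D - - (2 * D) by ring.
  by apply: lebesgue_measure_itvcc; lra.
pose f (x : measurableTypeR R) : \bar R := (\sum_(i < N) (\1_(K i) x)%:E)%E.
have fE x : f x = (\sum_(i < N) \1_(K i) x)%:E by rewrite /f sumEFin.
have cmp x : `|\sum_(i < N) \1_(K i) x - s / d * g x| <= \1_J x.
  have [h|nh] := pselect (hits Om ph x).
    have xJ : J x by rewrite /J /= in_itv /= -ler_norml; exact: hits_bounded OD h.
    have -> : \1_J x = 1 :> R by rewrite indicE mem_set.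
    have -> : \sum_(i < N) \1_(K i) x = \sum_(i < N)
        (crossing_lo Om ph x th <= p + i%:R * d <= crossing_hi Om ph x th)%R%:R :> R.
      apply: eq_bigr => i _; rewrite indicE; congr (_ %:R); congr nat_of_bool.
      apply/idP/idP => [|H].
        rewrite inE => -[hi]; move=> /(meetP _ hi s0')[y [Oy y1 y2]].
        by apply/(meetP _ h s0); exists y.
      have [y [Oy y1 y2]] := (meetP _ h s0).1 H.
      have hi : hits Om th (p + i%:R * d) by exists (tproj th y); rewrite -y2 pntK.
      by rewrite inE; split => //; apply/(meetP _ hi s0'); exists y.
    have -> : s / d * g x = (crossing_hi Om ph x th - crossing_lo Om ph x th) / d.
      by rewrite crossing_width // chordE // /g -/s mulrC mulrA.
    have pb t : Om (pnt ph x t) -> `|nproj th (pnt ph x t)| <= 2 * D.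
      move=> Ot; apply: (hits_bounded OD (th := th)).
      by exists (tproj th (pnt ph x t)); rewrite pntK.
    have /pb/ler_normlP[l1 l2] : Om (pnt ph x (slo Om ph x)).
      by apply/(sectionP bOm _ h); rewrite lexx slo_le_shi.
    have /pb/ler_normlP[h1 h2] : Om (pnt ph x (shi Om ph x)).
      by apply/(sectionP bOm _ h); rewrite lexx slo_le_shi.
    apply: count_lattice => //.
    - by rewrite lt_min; apply/andP; split; lra.
    - by rewrite gt_max; apply/andP; split; lra.
    - rewrite crossing_width // (@le_trans _ _ 0) ?oppr_le0 ?(ltW d0) //.
      by rewrite mulr_ge0 // chordE // subr_ge0 slo_le_shi.
  rewrite big1 => [|i _]; last first.
    rewrite indicE memNset // => -[hi] /(meetP _ hi s0')[y [Oy y1 y2]].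
    by apply: nh; exists (tproj ph y); rewrite -y2 pntK.
  have -> : g x = 0.
    rewrite /g /slo /shi (_ : [set t | _] = set0) ?inf0 ?sup0 ?subrr //.
    by rewrite -subset0 => t ?; apply: nh; exists t.
  by rewrite mulr0 subrr normr0 indicE.
have g0 x : 0 <= g x by rewrite subr_ge0 slo_le_shi.
have sd : 0 <= s / d by rewrite divr_ge0 //; lra.
have i0 (A : set (measurableTypeR R)) x : 0 <= \1_A x :> R by rewrite indicE.
have mi (A : set (measurableTypeR R)) : measurable A ->
    measurable_fun setT (fun x => (\1_A x : R)%:E).
  by move=> mA; apply/measurable_EFinP; exact: measurable_indic.
have mf : measurable_fun setT f.
  by apply: emeasurable_sum => i _; apply: mi; have [] := KE i.
have f0 x : (0 <= f x)%E by rewrite fE lee_fin sumr_ge0.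
have intf : (\int[mu]_x f x = (\sum_(i < N) chord Om th (p + i%:R * d) * s)%:E)%E.
  rewrite ge0_integral_sum //; last by move=> i; apply: mi; have [] := KE i.
  rewrite -sumEFin; apply: eq_bigr => i _.
  by rewrite integral_indic // ?setIT; have [] := KE i.
have intJ : (\int[mu]_x (\1_J x)%:E = (4 * D)%:E)%E by rewrite integral_indic // setIT.
have mcg : measurable_fun setT (fun x => ((s / d)%:E * (g x)%:E)%E).
  exact: measurable_funeM.
have intg : (\int[mu]_x ((s / d)%:E * (g x)%:E) = (s / d)%:E * leb2 Om)%E.
  by rewrite ge0_integralZl ?lee_fin //; [rewrite gE|move=> x _; rewrite lee_fin].
have up : ((s / d)%:E * leb2 Om <= (\sum_(i < N) chord Om th (p + i%:R * d) * s + 4 * D)%:E)%E.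
  rewrite -intg EFinD -intf -intJ -ge0_integralD //; [|exact: mi].
  apply: ge0_le_integral => //.
  - by move=> x _; rewrite mule_ge0 // lee_fin.
  - by apply: emeasurable_funD => //; exact: mi.
  - move=> x _; rewrite fE -EFinM -EFinD lee_fin.
    by have /ler_normlP[] := cmp x; lra.
have lo : ((\sum_(i < N) chord Om th (p + i%:R * d) * s)%:E <= (s / d)%:E * leb2 Om + (4 * D)%:E)%E.
  rewrite -intg -intf -intJ -ge0_integralD //; [|by move=> x _; rewrite mule_ge0 // lee_fin|exact: mi].
  apply: ge0_le_integral => //.
  - by apply: emeasurable_funD => //; exact: mi.
  - move=> x _; rewrite fE -EFinM -EFinD lee_fin.
    by have /ler_normlP[] := cmp x; lra.
(* Finiteness of the area comes out of [up], whose left side would otherwise be infinite. *)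
have fin : leb2 Om \is a fin_num.
  rewrite ge0_fin_numE ?measure_ge0 // ltey; apply/negP => /eqP E.
  by move: up; rewrite E gt0_muley ?lte_fin ?divr_gt0 //; lra.
split => //; rewrite /area -/(leb2 Om).
move: up lo; rewrite -(fineK fin) -!EFinM -EFinD !lee_fin /= -mulr_suml.
set A := fine _; set S := \sum_(i < N) _ => up lo.
have sg : 0 < s by lra.
(* [J] has length [4 * D]; dividing by [s >= 1 / 2] at most doubles it. *)
have up' : A / d - S <= 8 * D.
  rewrite -(ler_pM2l sg).
  have -> : s * (A / d - S) = s / d * A - S * s by ring.
  by nra.
have lo' : S - A / d <= 8 * D.
  rewrite -(ler_pM2l sg).
  have -> : s * (S - A / d) = S * s - s / d * A by ring.
  by nra.
by rewrite ler_norml; apply/andP; split; lra.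
Qed.

Lemma lattice_length D th p d N :
  (forall x, Om x -> `|x.1| <= D /\ `|x.2| <= D) -> 0 <= D ->
  0 < d -> p - d < - (2 * D) -> 2 * D < p + N%:R * d ->
  0 < area Om /\ `|\sum_(i < N) chord Om th (p + i%:R * d) - area Om / d| <= 8 * D.
Proof.
move=> OD D0 d0 pl pr.
have [ph hph s12] : exists2 ph : R, ph = 0 \/ ph = pi / 2 & 1 / 2 <= `|sin (th - ph)|.
  have h := cos2Dsin2 th.
  have [s|s] := leP (1 / 2) `|sin th|; first by exists 0; rewrite ?subr0; [left|].
  exists (pi / 2); first by right.
  rewrite sinBpihalf normrN; have [//|c] := leP (1 / 2) `|cos th|.
  rewrite -[cos th ^+ 2]real_normK ?num_real // -[sin th ^+ 2]real_normK ?num_real // in h.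
  have := normr_ge0 (cos th); have := normr_ge0 (sin th); nra.
have [fin H] := lattice_length_transverse OD D0 hph s12 d0 pl pr; split => //.
by rewrite /area fine_gt0 // leb2_gt0 -ge0_fin_numE ?measure_ge0.
Qed.

End Area.

(** * Balancing shifted lattices; shadows of segments *)

Section Lattices.
Variable R : realType.

(** [n] copies of a lattice, shifted by multiples of the [n]-th part of its spacing, interleave to
    one lattice with that finer spacing. *)
Lemma sum_lattice_split (F : nat -> R) (n N : nat) :
  \sum_(j < n) \sum_(i < N) F (i * n + j)%N = \sum_(s < N * n) F s.
Proof.
rewrite exchange_big -(big_mkord xpredT F) big_nat_mul big_mkord /=.
apply: eq_bigr => i _; rewrite -[X in \sum_(X <= _ < _) _]add0n big_addn mulSn addnK big_mkord.
by apply: eq_bigr => j _; rewrite addnC.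
Qed.

(** The hypothesis on [phi] is used at two spacings: at [d] it bounds each error by [B], and at
    [d / n] it bounds the sum of the errors over all [n] shifts by [B]. So [balanced_choice] applies
    with [e = B / n]. *)
Lemma lattice_balance (T : finType) (n N : nat) (phi : T -> 'I_n -> R -> R)
    (mean : T -> 'I_n -> R) (B P d lam tau : R) :
  (0 < n)%N -> (0 < #|T|)%N -> 0 < d -> 0 < lam -> lam * B <= 1 / 2 ->
  2 * P < N%:R * d -> 2 * #|T|%:R <= expR tau ->
  (forall t k p d' N', d / n%:R <= d' -> p - d' < - P -> P < p + N'%:R * d' ->
    `|\sum_(i < N') phi t k (p + i%:R * d') - mean t k / d'| <= B) ->
  exists w : 'I_n -> 'I_n, forall t,
    `|\sum_k \sum_(i < N) phi t k (- P + (w k)%:R / n%:R * d + i%:R * d)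
      - (\sum_k mean t k) / d| <= tau / lam + B + 2 * n%:R * lam * B ^+ 2.
Proof.
move=> n0 T0 d0 l0 lB NP Ttau phiB.
have n0R : 0 < n%:R :> R by rewrite ltr0n.
have n1 : 1 <= n%:R :> R by rewrite ler1n.
pose Y t k (j : 'I_n) := \sum_(i < N) phi t k (- P + j%:R / n%:R * d + i%:R * d) - mean t k / d.
(* The boolean is a sign: each test is run in both directions, whence the factor 2 before [#|T|]. *)
pose X (tb : T * bool) k j := (if tb.2 then Y tb.1 k j else - Y tb.1 k j).
have [||||w H] := @balanced_choice R n n _ X B lam (B / n%:R) tau n0 _ l0 lB.
- by rewrite card_prod card_bool muln_gt0 T0.
- move=> [t b] k j; have : `|Y t k j| <= B.
    have jn : 0 <= (j%:R / n%:R : R) < 1.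
      by rewrite ltr_pdivrMr // mul1r ltr_nat ltn_ord andbT divr_ge0.
    have jd : 0 <= j%:R / n%:R * d < d.
      by move: jn => /andP[j1 j2]; rewrite mulr_ge0 ?(ltW d0) //= gtr_pMl.
    by apply: phiB; [rewrite ler_pdivrMr // ler_peMr // ltW|lra|lra].
  by rewrite /X /=; case: b; rewrite ?normrN.
- move=> [t b] k; have : `|\sum_j Y t k j| <= B.
    have dn0 : 0 < d / n%:R by rewrite divr_gt0.
    have -> : \sum_j Y t k j = \sum_(s < N * n) phi t k (- P + s%:R * (d / n%:R)) - mean t k / (d / n%:R).
      rewrite -(sum_lattice_split (fun s => phi t k (- P + s%:R * (d / n%:R)))).
      rewrite sumrB; congr (_ - _).
        apply: eq_bigr => j _; apply: eq_bigr => i _; congr phi.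
        by rewrite natrD natrM; field; rewrite gt_eqF.
      by rewrite sumr_const card_ord -mulr_natr; field; rewrite !gt_eqF.
    apply: phiB => //; first by lra.
    have -> : (N * n)%:R * (d / n%:R) = N%:R * d by rewrite natrM; field; rewrite gt_eqF.
    lra.
  rewrite divfK ?gt_eqF // => /ler_normlP[h1 h2]; rewrite /X /=.
  by case: b => //; rewrite sumrN.
- by rewrite card_prod card_bool natrM mulrC.
have nB : n%:R * (B / n%:R) = B by field; rewrite gt_eqF.
exists w => t; have := H (t, true); have := H (t, false); rewrite /X /= nB.
have -> : \sum_k \sum_(i < N) phi t k (- P + (w k)%:R / n%:R * d + i%:R * d)
      - (\sum_k mean t k) / d = \sum_k Y t k (w k) by rewrite sumrB mulr_suml.
by rewrite sumrN => h1 h2; rewrite ler_norml; apply/andP; split; lra.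
Qed.

Implicit Types (a b x y : pt R) (th D d : R).

(** For the two ends of a chord, [shadow_lo] and [shadow_hi] are [crossing_lo] and [crossing_hi];
    here the ends vary freely so that they can be rounded. *)
Definition shadow_lo th a b : R := Num.min (nproj th a) (nproj th b).
Definition shadow_hi th a b : R := Num.max (nproj th a) (nproj th b).

Lemma nproj_close th (x y : pt R) (e : R) : `|x.1 - y.1| <= e -> `|x.2 - y.2| <= e ->
  `|nproj th x - nproj th y| <= 2 * e.
Proof.
move=> h1 h2.
have -> : nproj th x - nproj th y = (x.1 - y.1) * cos th + (x.2 - y.2) * sin th.
  by rewrite /nproj; ring.
rewrite (le_trans (ler_normD _ _)) // !normrM mulr2n mulrDl !mul1r.
by rewrite lerD // -[leRHS]mulr1 ler_pM // ?cos_max ?sin_max.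
Qed.

Lemma shadow_close th a b a' b' (e : R) : `|nproj th a - nproj th a'| <= e ->
  `|nproj th b - nproj th b'| <= e ->
  `|shadow_lo th a b - shadow_lo th a' b'| <= e /\ `|shadow_hi th a b - shadow_hi th a' b'| <= e.
Proof.
rewrite /shadow_lo /shadow_hi; move: (nproj _ _) (nproj _ _) (nproj _ _) (nproj _ _) => u v u' v'.
rewrite !ler_norml => /andP[h1 h2] /andP[h3 h4].
by case: (leP u u') => ?; case: (leP v v') => ?; split; apply/andP; split; lra.
Qed.

Lemma grid_close D (eta : R) (x : R) : 0 < eta -> `|x| <= D ->
  exists i : 'I_(Num.truncn (2 * D / eta)).+1, `|x - (- D + i%:R * eta)| <= eta.
Proof.
move=> e0 /ler_normlP[x1 x2].
have y0 : 0 <= (x + D) / eta by rewrite divr_ge0 //; lra.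
have /andP[t1 t2] := truncn_itv y0.
have lt : (Num.truncn ((x + D) / eta) < (Num.truncn (2 * D / eta)).+1)%N.
  by rewrite ltnS le_truncn // ler_pM2r ?invr_gt0 //; lra.
exists (Ordinal lt) => /=; move: t1 t2; rewrite -[_.+1%:R]natr1 ler_pdivlMr // ltr_pdivrMr //.
by move=> t1 t2; rewrite ler_norml; apply/andP; split; lra.
Qed.

End Lattices.

(** * Shifts that pass the tests for all segments at once *)

Section BalancedLattices.
Variables (R : realType) (Om : set (pt R)) (D : R).
Hypothesis bOm : convex_body Om.
Hypothesis OD : forall x, Om x -> `|x.1| <= D /\ `|x.2| <= D.
Hypothesis D1 : 1 <= D.
Implicit Types (d lam tau : R).

Definition dir_angle (n k : nat) : R := pi * k%:R / n%:R.

(** Shadows lie in [-2D, 2D]; the extra 1 leaves room for their enlargement. *)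
Definition lattice_offset (n : nat) d (w : 'I_n -> 'I_n) (k : 'I_n) (i : nat) : R :=
  - (2 * D + 1) + (w k)%:R / n%:R * d + i%:R * d.

(** The bound of [lattice_balance] for [B = 8 * D + 1], which dominates both the error 1 of a count
    and the error [8 * D] of a length. *)
Definition fluct (n : nat) lam tau : R :=
  tau / lam + (8 * D + 1) + 2 * n%:R * lam * (8 * D + 1) ^+ 2.

Lemma nproj_bounded th x : `|x.1| <= D -> `|x.2| <= D -> `|nproj th x| <= 2 * D.
Proof.
move=> h1 h2; have := @nproj_close R th x (0, 0) D.
by rewrite /nproj /= !subr0 !mul0r addr0 subr0; apply.
Qed.

Lemma shadow_lo_le_hi th (a b : pt R) : shadow_lo th a b <= shadow_hi th a b.
Proof. by rewrite /shadow_lo /shadow_hi ge_min !le_max lexx. Qed.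

(* The tests: numbers of lattice points in the shadows of all pairs of points of a
   fine grid, slightly enlarged and slightly shrunk, and the total length. *)
Lemma balanced_lattices (n N : nat) d lam tau :
  (0 < n)%N -> 0 < d <= 1 -> 0 < lam -> lam * (8 * D + 1) <= 1 / 2 ->
  2 * (2 * D + 1) < N%:R * d ->
  2 * (2 * (Num.truncn (2 * D / (d / (8 * n%:R)))).+1%:R ^+ 4 + 1) <= expR tau ->
  exists w : 'I_n -> 'I_n,
    `|\sum_(k < n) \sum_(i < N) chord Om (dir_angle n k) (lattice_offset d w k i) - n%:R * area Om / d|
       <= fluct n lam tau /\
    forall a b : pt R, `|a.1| <= D -> `|a.2| <= D -> `|b.1| <= D -> `|b.2| <= D ->
      (\sum_(k < n) \sum_(i < N)
          (shadow_lo (dir_angle n k) a b <= lattice_offset d w k i <= shadow_hi (dir_angle n k) a b)%R%:R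
        <= \sum_(k < n) (shadow_hi (dir_angle n k) a b - shadow_lo (dir_angle n k) a b) / d
           + fluct n lam tau + 2) /\
      (\sum_(k < n) (shadow_hi (dir_angle n k) a b - shadow_lo (dir_angle n k) a b) / d
           - fluct n lam tau - 2 <=
       \sum_(k < n) \sum_(i < N)
          (shadow_lo (dir_angle n k) a b < lattice_offset d w k i < shadow_hi (dir_angle n k) a b)%R%:R).
Proof.
move=> n0 /andP[d0 d1] l0 lB Nd Ttau.
have n0R : 0 < n%:R :> R by rewrite ltr0n.
have n1 : 1 <= n%:R :> R by rewrite ler1n.
have D0 : 0 <= D := le_trans ler01 D1.
have D1' := D1.
(* Rounding to the grid moves shadow ends by at most [2 * eta]; changing the shadows by [4 * eta] at
   each end absorbs this with strict inequalities. The width changes by at most [16 * eta] per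
   direction, in all [16 * eta * n / d = 2]. A shrunken shadow is reversed by at most
   [8 * eta = d / n], as [count_lattice] permits. *)
pose eta : R := d / (8 * n%:R).
have eta0 : 0 < eta by rewrite /eta divr_gt0 // mulr_gt0.
have nid : n%:R * (8 * eta) = d by rewrite /eta; field; rewrite gt_eqF.
have eta1 : 8 * eta <= d by rewrite -nid ler_peMl //; lra.
set G := (Num.truncn _).+1 in Ttau.
pose gr (u : 'I_G * 'I_G) : pt R := (- D + u.1%:R * eta, - D + u.2%:R * eta).
have grD u : `|(gr u).1| <= D /\ `|(gr u).2| <= D.
  have c (i : 'I_G) : `|- D + i%:R * eta| <= D.
    have y0 : 0 <= 2 * D / eta by rewrite divr_ge0 ?mulr_ge0 // ltW.
    have /andP[t1 _] := truncn_itv y0.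
    have : i%:R <= (Num.truncn (2 * D / eta))%:R :> R by rewrite ler_nat -ltnS.
    move=> /le_trans /(_ t1); rewrite ler_pdivlMr // => t2.
    have := mulr_ge0 (ler0n R i) (ltW eta0); move: (_ * eta) t2 => z *.
    by rewrite ler_norml; apply/andP; split; lra.
  by split; exact: c.
pose T : finType := ((('I_G * 'I_G) * ('I_G * 'I_G)) * bool + unit)%type.
pose e (b : bool) : R := if b then 4 * eta else - (4 * eta).
pose phi (t : T) (k : 'I_n) p : R := match t with
  | inl (u, v, b) => (shadow_lo (dir_angle n k) (gr u) (gr v) - e b <= p <=
                      shadow_hi (dir_angle n k) (gr u) (gr v) + e b)%R%:R
  | inr _ => chord Om (dir_angle n k) p end.
pose mean (t : T) (k : 'I_n) : R := match t with
  | inl (u, v, b) => shadow_hi (dir_angle n k) (gr u) (gr v)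
                     - shadow_lo (dir_angle n k) (gr u) (gr v) + 2 * e b
  | inr _ => area Om end.
have T0 : (0 < #|T|)%N by apply/card_gt0P; exists (inr tt).
have cT : 2 * #|T|%:R <= expR tau.
  suff -> : #|T|%:R = 2 * G%:R ^+ 4 + 1 :> R by [].
  rewrite /T card_sum !card_prod card_bool card_unit !card_ord natrD !natrM.
  by ring.
have eb b : - (4 * eta) <= e b <= 4 * eta by rewrite /e; case: b; lra.
have [|w H] := lattice_balance (P := 2 * D + 1) n0 T0 d0 l0 lB Nd cT (phi := phi) (mean := mean).
  move=> [[[u v] b]|[]] k p d' N' dd' pl pr /=.
    have d'0 : 0 < d' by apply: lt_le_trans dd'; rewrite divr_gt0.
    have dd'' : 8 * eta <= d' by rewrite (le_trans _ dd') // ler_pdivlMr // mulrC nid.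
    have [u1 u2] := grD u; have [v1 v2] := grD v.
    have /ler_normlP[hu1 hu2] := nproj_bounded (dir_angle n k) u1 u2.
    have /ler_normlP[hv1 hv2] := nproj_bounded (dir_angle n k) v1 v2.
    have mm := shadow_lo_le_hi (dir_angle n k) (gr u) (gr v).
    have m1 : - (2 * D) <= shadow_lo (dir_angle n k) (gr u) (gr v).
      rewrite /shadow_lo le_min; apply/andP; split; rewrite lerNl; [exact: hu1|exact: hv1].
    have m2 : shadow_hi (dir_angle n k) (gr u) (gr v) <= 2 * D.
      by rewrite /shadow_hi ge_max; apply/andP; split; [exact: hu2|exact: hv2].
    have /andP[e1 e2] := eb b.
    have -> : shadow_hi (dir_angle n k) (gr u) (gr v) - shadow_lo (dir_angle n k) (gr u) (gr v) + 2 * e b =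
      (shadow_hi (dir_angle n k) (gr u) (gr v) + e b) -
      (shadow_lo (dir_angle n k) (gr u) (gr v) - e b) by ring.
    apply: (le_trans (count_lattice _ _ _ _)) => //;
      clear -pl pr e1 e2 m1 m2 mm dd'' eta0 eta1 d1 D1'; lra.
  have d'0 : 0 < d' by apply: lt_le_trans dd'; rewrite divr_gt0.
  have pl' : p - d' < - (2 * D) by lra.
  have pr' : 2 * D < p + N'%:R * d' by lra.
  have [_ h] := lattice_length bOm (dir_angle n k) OD D0 d'0 pl' pr'.
  by rewrite /= (le_trans h) // lerDl.
exists w; split; first by have := H (inr tt); rewrite /= sumr_const card_ord -[area Om *+ n]mulr_natl.
move=> a b a1 a2 b1 b2.
have [i1 A1] := grid_close eta0 a1; have [i2 A2] := grid_close eta0 a2.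
have [j1 B1] := grid_close eta0 b1; have [j2 B2] := grid_close eta0 b2.
pose u : 'I_G * 'I_G := (i1, i2); pose v : 'I_G * 'I_G := (j1, j2).
have cl k : `|shadow_lo (dir_angle n k) a b - shadow_lo (dir_angle n k) (gr u) (gr v)| <= 2 * eta /\
    `|shadow_hi (dir_angle n k) a b - shadow_hi (dir_angle n k) (gr u) (gr v)| <= 2 * eta.
  by apply: shadow_close; exact: nproj_close.
have sumE c : (\sum_(k < n) mean (inl (u, v, c)) k) / d <=
    \sum_(k < n) (shadow_hi (dir_angle n k) a b - shadow_lo (dir_angle n k) a b) / d +
      (if c then 2 else 0) /\
    \sum_(k < n) (shadow_hi (dir_angle n k) a b - shadow_lo (dir_angle n k) a b) / d -
      (if c then 0 else 2) <= (\sum_(k < n) mean (inl (u, v, c)) k) / d.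
  have two : \sum_(k < n) (16 * eta / d) = 2.
    by rewrite sumr_const card_ord -mulr_natr /eta; field; rewrite !gt_eqF.
  have key k : (mean (inl (u, v, c)) k) / d <=
        (shadow_hi (dir_angle n k) a b - shadow_lo (dir_angle n k) a b) / d
        + (if c then 16 * eta / d else 0) /\
      (shadow_hi (dir_angle n k) a b - shadow_lo (dir_angle n k) a b) / d
        - (if c then 0 else 16 * eta / d) <= (mean (inl (u, v, c)) k) / d.
    have [/ler_normlP[h1 h2] /ler_normlP[h3 h4]] := cl k.
    rewrite /mean /e; case: c; rewrite ?addr0 ?subr0 -?mulrDl -?mulrBl;
      split; rewrite ler_pM2r ?invr_gt0 //; clear -h1 h2 h3 h4 eta0; lra.
  split.
    rewrite mulr_suml; apply: (@le_trans _ _ (\sum_(k < n)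
        ((shadow_hi (dir_angle n k) a b - shadow_lo (dir_angle n k) a b) / d
         + (if c then 16 * eta / d else 0)))).
      by apply: ler_sum => k _; have [] := key k.
    rewrite big_split /= lerD2l; case: c key => _; first by rewrite two.
    by rewrite sumr_const mul0rn.
  rewrite mulr_suml; apply: (@le_trans _ _ (\sum_(k < n)
      ((shadow_hi (dir_angle n k) a b - shadow_lo (dir_angle n k) a b) / d
       - (if c then 0 else 16 * eta / d)))); last first.
    by apply: ler_sum => k _; have [] := key k.
  rewrite sumrB lerD2l lerN2; case: c key => _; last by rewrite two.
  by rewrite sumr_const mul0rn.
split.
  have /ler_normlP[_ h] := H (inl (u, v, true)); have [h' _] := sumE true.
  suff : \sum_(k < n) \sum_(i < N)
      (shadow_lo (dir_angle n k) a b <= lattice_offset d w k i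
         <= shadow_hi (dir_angle n k) a b)%R%:R <=
    \sum_(k < n) \sum_(i < N) phi (inl (u, v, true)) k (- (2 * D + 1) + (w k)%:R / n%:R * d + i%:R * d).
    by rewrite /fluct; lra.
  apply: ler_sum => k _; apply: ler_sum => i _; rewrite /phi /e -/(lattice_offset d w k i) ler_nat.
  have [/ler_normlP[h1 h2] /ler_normlP[h3 h4]] := cl k.
  case: (shadow_lo _ a b <= _ <= _) / andP => // -[g1 g2].
  rewrite (_ : _ <= _ <= _) //; clear -h1 h2 h3 h4 g1 g2 eta0.
  by apply/andP; split; lra.
have /ler_normlP[h _] := H (inl (u, v, false)); have [_ h'] := sumE false.
suff : \sum_(k < n) \sum_(i < N) phi (inl (u, v, false)) k (- (2 * D + 1) + (w k)%:R / n%:R * d + i%:R * d)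
  <= \sum_(k < n) \sum_(i < N)
       (shadow_lo (dir_angle n k) a b < lattice_offset d w k i
          < shadow_hi (dir_angle n k) a b)%R%:R.
  by rewrite /fluct; lra.
apply: ler_sum => k _; apply: ler_sum => i _; rewrite /phi /e -/(lattice_offset d w k i) ler_nat.
have [/ler_normlP[h1 h2] /ler_normlP[h3 h4]] := cl k.
case: (shadow_lo _ _ (gr v) - _ <= _ <= _) / andP => // -[g1 g2].
rewrite (_ : _ < _ < _) //; clear -h1 h2 h3 h4 g1 g2 eta0.
by apply/andP; split; lra.
Qed.

End BalancedLattices.

(** * The set of segments and its discrepancy *)

Section Construction.
Variables (R : realType) (Om : set (pt R)).
Hypothesis bOm : convex_body Om.
Implicit Types (th q d D r rho kap lam tau : R).

Definition admissible (z : R * R * R * R) : Prop :=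
  z.1.2 <= z.2 /\ seg_pts (mkseg z) `<=` Om.

(** Splitting [rho] into [M] equal pieces makes each at most [r] long; centred at [c] and displaced
    by at most [r / 2], they stay in the square for every direction [th]. *)
Lemma parallel_filler (c : pt R) r th rho : 0 < r ->
  (forall x, `|x.1 - c.1| <= r -> `|x.2 - c.2| <= r -> Om x) -> 0 <= rho ->
  exists Q : seq (R * R * R * R),
    [/\ uniq [seq z.1.1 | z <- Q],
        forall z, z \in Q -> z.1.1.1 = th /\ admissible z,
        \sum_(z <- Q) (z.2 - z.1.2) = rho &
        (size Q)%:R <= rho / r + 1].
Proof.
move=> r0 Oc rho0.
pose M := (Num.truncn (rho / r)).+1.
have M0 : 0 < M%:R :> R by rewrite ltr0n.
have rr0 : 0 <= rho / r by rewrite divr_ge0 // ltW.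
have /andP[M1 M2] := truncn_itv rr0; rewrite -/M in M2.
have rM : rho / M%:R <= r.
  by rewrite ler_pdivrMr // mulrC -ler_pdivrMr // ltW.
have rM0 : 0 <= rho / M%:R by rewrite divr_ge0 // ltW.
pose f (s : nat) : R * R * R * R :=
  (th, nproj th c + r / 2 * (s%:R / M%:R),
   tproj th c - rho / M%:R / 2, tproj th c + rho / M%:R / 2).
exists [seq f s | s <- iota 0 M]; split.
- rewrite -map_comp map_inj_uniq ?iota_uniq // => s s' [] /addrI.
  move=> /(mulfI (lt0r_neq0 (divr_gt0 r0 (ltr0Sn R 1)))).
  by move=> /(divIf (lt0r_neq0 M0)) /eqP; rewrite eqr_nat => /eqP.
- move=> z /mapP[s]; rewrite mem_iota add0n => /andP[_ sM] ->; split=> //.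
  split=> [/=|x]; first by lra.
  rewrite /mkseg /= => /pseg_ptsP[|t /andP[t1 t2] ->]; first by lra.
  have sM01 : 0 <= (s%:R / M%:R : R) <= 1.
    by rewrite divr_ge0 ?(ltW M0) //= ler_pdivrMr // mul1r ler_nat ltnW.
  move: sM01; set v := s%:R / M%:R => /andP[v0 v1].
  have h1 := congr1 fst (pntK th c); have h2 := congr1 snd (pntK th c).
  rewrite /= in h1 h2.
  pose al := r / 2 * v; pose be := t - tproj th c.
  have al1 : `|al| <= r / 2 by rewrite /al ger0_norm; nra.
  have be1 : `|be| <= r / 2 by rewrite /be ler_norml; apply/andP; split; lra.
  have bd (u u2 : R) : `|u| <= 1 -> `|u2| <= 1 -> `|al * u + be * u2| <= r.
    move=> hu hu2; rewrite (le_trans (ler_normD _ _)) // (normrM al) (normrM be) [leRHS]splitr.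
    by apply: lerD; rewrite -[leRHS]mulr1; apply: ler_pM.
  apply: Oc => /=.
    rewrite -h1.
    have -> : (nproj th c + r / 2 * v) * cos th - t * sin th -
      (nproj th c * cos th - tproj th c * sin th) = al * cos th + be * - sin th.
      by rewrite /al /be; ring.
    by apply: bd; rewrite ?normrN ?cos_max ?sin_max.
  rewrite -h2.
  have -> : (nproj th c + r / 2 * v) * sin th + t * cos th -
    (nproj th c * sin th + tproj th c * cos th) = al * sin th + be * cos th.
    by rewrite /al /be; ring.
  by apply: bd; rewrite ?cos_max ?sin_max.
- rewrite big_map (eq_bigr (fun=> rho / M%:R)) => [|s _ /=]; last by field; rewrite gt_eqF.
  by rewrite big_const_seq count_predT size_iota iter_addr_0 -mulr_natr; field; rewrite gt_eqF.
- by rewrite size_map size_iota /M -natr1 lerD2r.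
Qed.

Lemma dir_angle_bounds (n : nat) (k : 'I_n) : 0 <= dir_angle R n k < pi.
Proof.
have n0 : (0 < n)%N by apply: leq_ltn_trans (ltn_ord k).
have n0R : 0 < n%:R :> R by rewrite ltr0n.
have p0 := @pi_gt0 R.
rewrite /dir_angle divr_ge0 ?mulr_ge0 ?(ltW p0) ?(ltW n0R) //=.
by rewrite ltr_pdivrMr // ltr_pM2l // ltr_nat.
Qed.

Lemma dir_angle_inj (n : nat) (k k' : nat) : (0 < n)%N -> dir_angle R n k = dir_angle R n k' -> k = k'.
Proof.
move=> n0; rewrite /dir_angle => /(divIf (lt0r_neq0 _)); rewrite ltr0n => /(_ n0).
by move=> /(mulfI (lt0r_neq0 (@pi_gt0 R))) /eqP; rewrite eqr_nat => /eqP.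
Qed.

(** Lattice lines that miss [Om] are discarded, since the default [slo = shi = 0] would place a
    point outside [Om]. The last clause turns sums over the list back into sums over the
    lattices. *)
Lemma chord_family D (n N : nat) d (w : 'I_n -> 'I_n) : (0 < n)%N -> 0 < d ->
  exists Q : seq (R * R * R * R),
    [/\ uniq [seq z.1.1 | z <- Q],
        forall z, z \in Q -> (exists k : 'I_n, z.1.1.1 = dir_angle R n k) /\ admissible z &
        forall G : R * R * R * R -> R, \sum_(z <- Q) G z =
          \sum_(k < n) \sum_(i < N)
            if asbool (hits Om (dir_angle R n k) (lattice_offset D d w k i)) then
              G (dir_angle R n k, lattice_offset D d w k i,
                 slo Om (dir_angle R n k) (lattice_offset D d w k i),
                 shi Om (dir_angle R n k) (lattice_offset D d w k i))
            else 0].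
Proof.
move=> n0 d0.
pose f (k : 'I_n) (i : 'I_N) : R * R * R * R :=
  (dir_angle R n k, lattice_offset D d w k i,
   slo Om (dir_angle R n k) (lattice_offset D d w k i), shi Om (dir_angle R n k) (lattice_offset D d w k i)).
pose h (z : R * R * R * R) := asbool (hits Om z.1.1.1 z.1.1.2).
pose A := [seq f k i | k <- enum 'I_n, i <- enum 'I_N].
exists [seq z <- A | h z]; split.
- apply: (subseq_uniq (map_subseq _ (filter_subseq _ _))).
  rewrite map_allpairs allpairs_uniq ?enum_uniq // => -[k i] [k' i'] _ _ /= [/(dir_angle_inj n0) kk].
  have {}kk : k = k' by exact/val_inj.
  rewrite /lattice_offset kk => /addrI /(mulIf (lt0r_neq0 d0)) /eqP; rewrite eqr_nat => /eqP ii.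
  by congr (_, _); exact/val_inj.
- move=> z; rewrite mem_filter => /andP[hz /allpairsP[[k i] [_ _ /= zE]]].
  move: hz; rewrite {}zE /h /= => /asboolP hz; split; first by exists k.
  split; first exact: slo_le_shi.
  move=> x /pseg_ptsP[|t tt ->]; first exact: slo_le_shi.
  exact/(sectionP bOm).
- move=> G; rewrite big_filter big_mkcond /= /A big_allpairs_dep /= big_enum /=.
  by apply: eq_bigr => k _; rewrite big_enum.
Qed.

Lemma chord_miss th q : ~ hits Om th q -> chord Om th q = 0.
Proof.
move=> nh; rewrite chordE // /slo /shi (_ : [set t | _] = set0) ?inf0 ?sup0 ?subrr //.
by rewrite -subset0 => t ?; apply: nh; exists t.
Qed.

(** The error terms come, in order, from the fluctuation with grid rounding, the sum of sines, the
    crossings with the filler, and the aim at [L - kap] in place of [L]. *)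
Lemma discrepancy_bound D (c : pt R) r (n N : nat) d lam tau kap (L : R) :
  (forall x, Om x -> `|x.1| <= D /\ `|x.2| <= D) -> 1 <= D ->
  0 < r -> (forall x, `|x.1 - c.1| <= r -> `|x.2 - c.2| <= r -> Om x) ->
  0 < area Om ->
  (0 < n)%N -> 0 < d <= 1 -> 0 < lam -> lam * (8 * D + 1) <= 1 / 2 ->
  2 * (2 * D + 1) < N%:R * d ->
  2 * (2 * (Num.truncn (2 * D / (d / (8 * n%:R)))).+1%:R ^+ 4 + 1) <= expR tau ->
  fluct D n lam tau <= kap -> n%:R * area Om / d = L - kap ->
  exists S : seq (segment R),
    [/\ non_overlapping S,
        forall s, s \in S -> seg_pts s `<=` Om,
        total_length S = L &
        forall th q, 0 <= th < pi ->
          `|inter_count S th q - 2 * L / (pi * area Om) * chord Om th q|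
            <= kap + 2 + 4 * D / d * (2 / n%:R) + (2 * kap / r + 1)
               + 2 * kap / (pi * area Om) * (4 * D)].
Proof.
move=> OD D1 r0 Oc A0 n0 d01 l0 lB Nd Ttau Fkap ndL.
have n0R : 0 < n%:R :> R by rewrite ltr0n.
have [d0 d1] := andP d01.
have pi0 := @pi_gt0 R.
have [w [Hlen Hcross]] := balanced_lattices bOm OD D1 n0 d01 l0 lB Nd Ttau.
have [Q1 [uQ1 Q1P Q1E]] := chord_family D N w n0 d0.
set L1 := \sum_(k < n) \sum_(i < N) _ in Hlen.
have {Hlen} /ler_normlP[L1a L1b] : `|L1 - (L - kap)| <= kap by rewrite -ndL (le_trans Hlen).
have L1E : \sum_(z <- Q1) (z.2 - z.1.2) = L1.
  rewrite Q1E; apply: eq_bigr => k _; apply: eq_bigr => i _ /=.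
  by case: asboolP => h; [rewrite chordE|rewrite chord_miss].
have rho0 : 0 <= L - L1 by lra.
(* The filler angle is half a step, so it differs from every lattice direction: equality would mean
   [2 * k = 1]. *)
have [Q2 [uQ2 Q2P Q2E Q2s]] := parallel_filler (pi / (2 * n%:R)) r0 Oc rho0.
have thQ z : z \in Q1 ++ Q2 -> 0 <= z.1.1.1 < pi /\ admissible z.
  rewrite mem_cat => /orP[/Q1P[[k ->] az]|/Q2P[-> az]]; split=> //.
    exact: dir_angle_bounds.
  have n1 : 1 <= n%:R :> R by rewrite ler1n.
  by rewrite divr_ge0 ?(ltW pi0) ?mulr_ge0 //= ltr_pdivrMr ?mulr_gt0 // ltr_pMr //; lra.
exists [seq mkseg z | z <- Q1 ++ Q2]; split.
- apply: non_overlapping_mkseg => [|z /thQ[]//].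
  rewrite map_cat cat_uniq uQ1 uQ2 andbT /=; apply/hasPn => _ /mapP[z2 /Q2P[e2 _] ->].
  apply/negP => /mapP[z1 /Q1P[[k e1] _] E].
  have : pi / (2 * n%:R) = dir_angle R n k by rewrite -e1 -e2 E.
  have nn0 : n%:R != 0 :> R by rewrite gt_eqF.
  have nn2 : 2 * n%:R != 0 :> R by rewrite gt_eqF // mulr_gt0.
  rewrite /dir_angle => /eqP; rewrite eqr_div // => /eqP.
  have -> : pi * k%:R * (2 * n%:R) = pi * n%:R * (2 * k)%:R :> R by rewrite natrM; ring.
  rewrite -[LHS]mulr1 => /(mulfI (lt0r_neq0 (mulr_gt0 pi0 n0R))) /eqP.
  by rewrite eq_sym pnatr_eq1; case: (k : nat) => [|m]; rewrite ?muln0 // mulnS.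
- by move=> s /mapP[z /thQ[_ [_ zO]] ->].
- rewrite /total_length big_map.
  rewrite (eq_big_seq (fun z : R * R * R * R => z.2 - z.1.2)) => [|z /thQ[_ [zz _]]].
    by rewrite big_cat /= L1E Q2E; ring.
  exact: seg_len_pseg.
move=> th q thpi; rewrite /inter_count big_map.
have kap0 : 0 <= kap by lra.
have D0 : 0 <= D by lra.
have t1 : 0 <= 4 * D / d * (2 / n%:R) by apply: mulr_ge0; apply: divr_ge0; rewrite ?mulr_ge0 // ltW.
have t2 : 0 <= 2 * kap / r by rewrite divr_ge0 ?mulr_ge0 // ltW.
have piA : 0 < pi * area Om by rewrite mulr_gt0.
have t3 : 0 <= 2 * kap / (pi * area Om) by rewrite divr_ge0 ?mulr_ge0 // ltW.
have t4 : 0 <= 2 * kap / (pi * area Om) * (4 * D) by apply: mulr_ge0 => //; apply: mulr_ge0.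
have [h|nh] := pselect (hits Om th q); last first.
  rewrite chord_miss // mulr0 subr0 big_seq big1 ?normr0; first by lra.
  by move=> z /thQ[_ [_ zO]]; exact: cross_count_miss nh.
set W := chord Om th q.
have W0 : 0 <= W by rewrite /W chordE // subr_ge0 slo_le_shi.
have W4 : W <= 4 * D by exact: chord_le.
have filler : 0 <= \sum_(z <- Q2) cross_count (mkseg z) th q <= 2 * kap / r + 1.
  apply/andP; split.
    by apply: sumr_ge0 => z _; have /andP[] := cross_count_le1 (mkseg z) th q.
  apply: (@le_trans _ _ (size Q2)%:R).
    rewrite -[size Q2]count_predT -sum1_count natr_sum; apply: ler_sum => z _.
    by have /andP[] := cross_count_le1 (mkseg z) th q.
  by rewrite (le_trans Q2s) // lerD2r ler_pM2r ?invr_gt0 //; lra.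
set a := pnt th q (slo Om th q); set b := pnt th q (shi Om th q).
have Oa : Om a by apply/(sectionP bOm _ h); rewrite lexx slo_le_shi.
have Ob : Om b by apply/(sectionP bOm _ h); rewrite lexx slo_le_shi.
have [a1 a2] := OD _ Oa; have [b1 b2] := OD _ Ob.
have [up lo] := Hcross a b a1 a2 b1 b2.
have sinE : \sum_(k < n) (shadow_hi (dir_angle R n k) a b - shadow_lo (dir_angle R n k) a b) / d =
    W / d * \sum_(k < n) `|sin (pi * k%:R / n%:R - th)|.
  rewrite mulr_sumr; apply: eq_bigr => k _.
  have := crossing_width bOm th q (dir_angle R n k); rewrite /crossing_hi /crossing_lo => ->.
  by rewrite -/W /dir_angle mulrAC.
have Wd0 : 0 <= W / d by rewrite divr_ge0 // ltW.
have sins : `|W / d * \sum_(k < n) `|sin (pi * k%:R / n%:R - th)| - W / d * (2 * n%:R / pi)|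
    <= 4 * D / d * (2 / n%:R).
  rewrite -mulrBr normrM ger0_norm // ler_pM // ?sum_abs_sin //.
  by rewrite ler_pM2r ?invr_gt0.
(* By the choice of [d], [n / d] is [(L - kap) / area Om]. *)
have target : W / d * (2 * n%:R / pi) = 2 * L / (pi * area Om) * W - 2 * kap / (pi * area Om) * W.
  have dE : n%:R / d = (L - kap) / area Om by rewrite -ndL; field; rewrite !gt_eqF.
  have -> : W / d * (2 * n%:R / pi) = 2 * W / pi * (n%:R / d) by ring.
  rewrite dE; move: (pi) pi0 piA => p p0 pA; field.
  by rewrite !gt_eqF.
have kW : 0 <= 2 * kap / (pi * area Om) * W <= 2 * kap / (pi * area Om) * (4 * D).
  by rewrite mulr_ge0 //= ler_wpM2l.
rewrite big_cat /=; set I1 := \sum_(z <- Q1) _; set I2 := \sum_(z <- Q2) _ in filler *.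
have I1up : I1 <= W / d * \sum_(k < n) `|sin (pi * k%:R / n%:R - th)| + kap + 2.
  rewrite -sinE -addrA; apply: le_trans (le_trans up _); last first.
    by rewrite -addrA lerD2l lerD2r.
  rewrite /I1 Q1E; apply: ler_sum => k _; apply: ler_sum => i _.
  case: asboolP => // hi; apply: cross_count_le => //; first exact: slo_le_shi.
  move=> x /pseg_ptsP[|t tt ->]; first exact: slo_le_shi.
  exact/(sectionP bOm).
have I1lo : W / d * \sum_(k < n) `|sin (pi * k%:R / n%:R - th)| - kap - 2 <= I1.
  rewrite -sinE; apply: le_trans (le_trans _ lo) _.
    by rewrite lerD2r lerD2l lerN2.
  rewrite /I1 Q1E; apply: ler_sum => k _; apply: ler_sum => i _.
  have [hlt|_] := boolP (shadow_lo (dir_angle R n k) a b < lattice_offset D d w k i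
                           < shadow_hi (dir_angle R n k) a b).
    have [hi e1] := cross_count_eq1 bOm h hlt.
    by rewrite asboolT //= /mkseg /= e1.
  case: asboolP => // _; set s := mkseg _.
  by have /andP[] := cross_count_le1 s th q.
move: filler sins kW => /andP[f1 f2] /ler_normlP[s1 s2] /andP[k1 k2].
clear -I1up I1lo f1 f2 s1 s2 k1 k2 target t1 kap0.
by rewrite ler_norml; apply/andP; split; lra.
Qed.

End Construction.

(** * Choice of the parameters and conclusion *)

Lemma ln_le_root (R : realType) (K : R) : 0 < K ->
  exists L0 : R, forall L, L0 <= L -> 1 <= ln L /\ K * ln L <= L `^ (1 / 5).
Proof.
move=> K0; exists (expR 1 + (10 * K) ^+ 10) => L hL.
have K10 : 0 < 10 * K by rewrite mulr_gt0.
have e0 := expR_gt0 (1 : R).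
have k0 : 0 <= (10 * K) ^+ 10 by rewrite exprn_ge0 // ltW.
have L0 : 0 < L by lra.
split; first by rewrite -[leLHS]expRK ler_ln ?posrE //; lra.
(* Half of the exponent is spent on [ln L = 10 * ln c <= 10 * c], the other half on
   [10 * K <= c]. *)
set c := L `^ (1 / 10).
have c0 : 0 < c by exact: powR_gt0.
have cL : c ^+ 10 = L.
  by rewrite -powR_mulrn ?(ltW c0) // -powRrM mul1r mulVf // powRr1 // ltW.
have c2 : L `^ (1 / 5) = c ^+ 2.
  by rewrite -powR_mulrn ?(ltW c0) // -powRrM; congr (_ `^ _); field.
have lc : ln L = 10 * ln c by rewrite -{1}cL lnXn // mulr_natl.
have lcc := ltW (ln_sublinear c0).
have Kc : 10 * K <= c.
  by rewrite -(@ler_pXn2r _ 10) ?nnegrE ?(ltW c0) ?(ltW K10) // cL; lra.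
rewrite lc c2 mulrA; apply: (@le_trans _ _ (K * 10 * c)).
  by rewrite ler_wpM2l // mulr_ge0 // ltW.
by rewrite expr2 ler_pM2r // mulrC.
Qed.

(** With [a] and [b] the fifth roots of [L] and [ln L], all estimates are algebraic. For [n] of
    order [a ^ 2 / b] and [lam = b ^ 3 / a], the quantities [ln L / lam], [n * lam] and [L / n ^ 2]
    all have the order [a * b ^ 2]. The summands of [K] match the three terms of [fluct], and
    [tau = 10 * ln L] allows [L ^ 10] tests. *)
Lemma parameters (R : realType) (A D K a b : R) :
  let t := b ^+ 5 in let B := 8 * D + 1 in
  0 < A -> 1 <= D -> 1 <= b -> K = 10 + B + 4 * B ^+ 2 ->
  (2 * B + 2 * K + 4 * A + 16 * D / A + 7) * t <= a ->
  exists (n : nat) (d lam : R), [/\ (0 < n)%N, 0 < d <= 1, 0 < lam,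
    lam * B <= 1 / 2 &
    [/\ 2 * (2 * (Num.truncn (2 * D / (d / (8 * n%:R)))).+1%:R ^+ 4 + 1) <= (a ^+ 5) ^+ 10,
        fluct D n lam (10 * t) <= K * (a * b ^+ 2),
        n%:R * A / d = a ^+ 5 - K * (a * b ^+ 2) &
        4 * D / d * (2 / n%:R) <= 8 * D / A * (a * b ^+ 2)]].
Proof.
move=> t B A0 D1 b1 KE H.
have B9 : 9 <= B by rewrite /B; lra.
have K0 : 1 <= K by rewrite KE; nra.
have b0 : 0 < b by lra.
have t1 : 1 <= t by rewrite exprn_ege1.
have b2t : b ^+ 2 <= t by rewrite ler_weXn2l.
have b3t : b ^+ 3 <= t by rewrite ler_weXn2l.
have bt : b <= t by rewrite -[leLHS]expr1 ler_weXn2l.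
have DA : 0 < 16 * D / A by rewrite divr_gt0 //; lra.
have at_ (x y : R) : 0 <= x -> x <= 2 * B + 2 * K + 4 * A + 16 * D / A + 7 ->
    0 <= y -> y <= t -> x * y <= a.
  by move=> x0 xK y0 yt; rewrite (le_trans _ H) // ler_pM.
have a7 : 16 * D / A + 7 <= a by rewrite -[leLHS]mulr1; apply: at_; lra.
have aA : 4 * A <= a by rewrite -[leLHS]mulr1; apply: at_; lra.
have a1 : 1 <= a by lra.
have a0 : 0 < a by lra.
have ab : b <= a by rewrite -[leLHS]mul1r; apply: at_; lra.
pose L := a ^+ 5; pose E := a * b ^+ 2.
have E0 : 1 <= E by rewrite /E -[leLHS]mulr1 ler_pM // exprn_ege1.
have a2L : a ^+ 2 <= L by rewrite ler_weXn2l.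
have KL : K * E <= L / 2.
  have : 2 * K * b ^+ 2 <= a by apply: at_; rewrite ?exprn_ge0 //; lra.
  rewrite /E; move: (b ^+ 2) => b2 h; rewrite expr2 in a2L.
  by have := ler_wpM2l (ltW a0) h; lra.
pose nu := a ^+ 2 / b.
have nu1 : 1 <= nu.
  by rewrite ler_pdivlMr // mul1r (le_trans ab) // -[leLHS]expr1 ler_weXn2l.
have /andP[n1 n2] := truncn_itv (le_trans ler01 nu1).
pose n := (Num.truncn nu).+1.
have nnu : nu <= n%:R by exact: ltW.
have n2nu : n%:R <= 2 * nu by rewrite /n -natr1; lra.
have n0 : 0 < n%:R :> R by rewrite ltr0n.
have L0 : 0 < L by rewrite exprn_gt0.
have LK : 0 < L - K * E by lra.
(* [d] is solved from the required total length [n * A / d = L - kap] with [kap = K * E]; [KL] keeps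
   the denominator at least [L / 2]. *)
pose d := n%:R * A / (L - K * E).
have d0 : 0 < d by rewrite divr_gt0 // mulr_gt0.
have nd : n%:R / d = (L - K * E) / A by rewrite /d; field; rewrite !gt_eqF.
have nE : L <= E * n%:R ^+ 2.
  have -> : L = E * nu ^+ 2 by rewrite /L /E /nu; field; rewrite gt_eqF.
  rewrite ler_pM2l; last by lra.
  by rewrite ler_pXn2r // nnegrE; lra.
exists n, d, (b ^+ 3 / a); split=> //.
- rewrite d0 ler_pdivrMr // mul1r.
  have nua : nu <= a ^+ 2 by rewrite ler_pdivrMr // ler_peMr // exprn_ge0 // ltW.
  have nA : n%:R * A <= 2 * a ^+ 2 * A by rewrite ler_pM2r //; lra.
  have : a ^+ 2 * (4 * A) <= L.
    have -> : L = a ^+ 2 * a ^+ 3 by rewrite /L -exprD.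
    rewrite ler_pM2l ?exprn_gt0 // (le_trans aA) // -[leLHS]expr1 ler_weXn2l //.
  lra.
- by rewrite divr_gt0 // exprn_gt0.
- rewrite mulrAC ler_pdivrMr //.
  have : 2 * B * b ^+ 3 <= a by apply: at_; rewrite ?exprn_ge0 //; lra.
  by lra.
split.
- set G := (Num.truncn _).+1.
  have L1 : a <= L by rewrite -[leLHS]expr1 ler_weXn2l.
  have GL : G%:R <= L ^+ 2.
    have E1 : 2 * D / (d / (8 * n%:R)) = 16 * D / A * (L - K * E).
      by rewrite /d; field; rewrite !gt_eqF.
    have y0 : 0 <= 2 * D / (d / (8 * n%:R)) by rewrite E1 mulr_ge0 // ltW.
    have /andP[g1 _] := truncn_itv y0.
    rewrite /G -natr1; apply: (@le_trans _ _ (16 * D / A * L + 1)).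
      rewrite lerD2r (le_trans g1) // E1 ler_pM2l //.
      by have := @mulr_ge0 _ K E; lra.
    rewrite expr2; apply: (@le_trans _ _ ((16 * D / A + 1) * L)); first by rewrite mulrDl mul1r; lra.
    by rewrite ler_pM2r; lra.
  have G8 : G%:R ^+ 4 <= L ^+ 8.
    have -> : L ^+ 8 = (L ^+ 2) ^+ 4 by rewrite -exprM.
    by rewrite ler_pXn2r ?nnegrE ?exprn_ge0 // ltW.
  have L8 : 1 <= L ^+ 8 by rewrite exprn_ege1 //; lra.
  have L9 : L ^+ 8 * 7 <= L ^+ 9 by rewrite [L ^+ 9]exprSr ler_pM2l ?exprn_gt0 //; lra.
  have L10 : L ^+ 9 <= L ^+ 10 by rewrite ler_weXn2l //; lra.
  by rewrite -/L; lra.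
- rewrite /fluct -/B KE.
  have -> : 10 * t / (b ^+ 3 / a) = 10 * E by rewrite /t /E; field; rewrite !gt_eqF.
  have h1 : n%:R * (b ^+ 3 / a) <= 2 * E.
    have -> : 2 * E = 2 * nu * (b ^+ 3 / a) by rewrite /E /nu; field; rewrite !gt_eqF.
    by rewrite ler_pM2r // divr_gt0 // exprn_gt0.
  have h2 := ler_wpM2r (sqr_ge0 B) h1.
  have h3 : B <= B * E by rewrite ler_peMr //; lra.
  rewrite -/E; have -> : 2 * n%:R * (b ^+ 3 / a) * B ^+ 2 =
    2 * (n%:R * (b ^+ 3 / a) * B ^+ 2) by ring.
  by move: h2 h3 {h1}; rewrite -/E -/B; move: (n%:R * _) (B) (E) => u v w h2 h3; lra.
- by rewrite -/L -/E /d; field; rewrite !gt_eqF.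
rewrite -/E.
have -> : 4 * D / d * (2 / n%:R) = 8 * D / A * ((L - K * E) / n%:R ^+ 2).
  by rewrite /d; field; rewrite !gt_eqF.
rewrite ler_wpM2l ?divr_ge0 ?(ltW A0) //; first by lra.
rewrite ler_pdivrMr ?exprn_gt0 // (le_trans _ nE) //.
by have := @mulr_ge0 _ K E; lra.
Qed.

Theorem theorem1 (R : realType) (Om : set (pt R)) :
  convex_body Om ->
  exists C : R, exists L0 : R, forall L : R, L0 <= L ->
    exists S : seq (segment R),
      non_overlapping S /\
      (forall s, s \in S -> seg_pts s `<=` Om) /\
      total_length S = L /\
      disc_le Om S (C * L `^ (1 / 5) * (ln L) `^ (2 / 5)).
Proof.
move=> bOm.
have [D D1 OD] := convex_body_bounded bOm.
have [c [r [r0 Oc]]] := convex_body_square bOm.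
have D0 : 0 <= D by lra.
set A := area Om.
have A0 : 0 < A.
  have /andP[_ t2] := @truncn_itv _ (4 * D) (mulr_ge0 (ler0n _ _) D0).
  have [] := @lattice_length R Om bOm D 0 (- (2 * D)) 1 (Num.truncn (4 * D)).+1 OD D0 ltr01 => //;
    by rewrite ?mulr1; lra.
pose B := 8 * D + 1; pose K := 10 + B + 4 * B ^+ 2.
have K0 : 0 < K by rewrite /K /B; nra.
pose K1 := 2 * B + 2 * K + 4 * A + 16 * D / A + 7.
have DA : 0 <= D / A by rewrite divr_ge0 // ltW.
have K10 : 0 < K1 by rewrite /K1 -mulrA /B; lra.
have [L0 HL] := ln_le_root K10.
(* The terms of [discrepancy_bound] divided by [E = a * b ^ 2], using [E >= 1] for the constant ones
   and [pi >= 1] for the last. *)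
exists (K + 2 + 8 * D / A + (2 * K / r + 1) + 8 * K * D / A), (Num.max L0 1) => L.
rewrite ge_max => /andP[/HL[l1 KL] L1].
pose a := L `^ (1 / 5); pose b := ln L `^ (1 / 5).
have l0 : 0 <= ln L by lra.
have L0' : 0 <= L by lra.
have aL : a ^+ 5 = L.
  by rewrite -powR_mulrn ?powR_ge0 // -powRrM mul1r mulVf // powRr1.
have bl : b ^+ 5 = ln L.
  by rewrite -powR_mulrn ?powR_ge0 // -powRrM mul1r mulVf // powRr1.
have b2 : ln L `^ (2 / 5) = b ^+ 2.
  by rewrite -powR_mulrn ?powR_ge0 // -powRrM; congr (_ `^ _); field.
have b1 : 1 <= b by rewrite -(@expr_ge1 _ 5) ?powR_ge0 // bl.
have := @parameters R A D K a b A0 D1 b1 erefl; rewrite bl => /(_ KL).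
move=> [n [d [lam [n0 d01 lam0 lamB [hT hF hd hn]]]]].
have [d0 _] := andP d01.
rewrite aL in hT hd.
have hT' : 2 * (2 * (Num.truncn (2 * D / (d / (8 * n%:R)))).+1%:R ^+ 4 + 1) <= expR (10 * ln L).
  by rewrite expRM_natl lnK // posrE; lra.
have y0 : 0 <= 2 * (2 * D + 1) / d by rewrite divr_ge0 ?(ltW d0) //; lra.
have /andP[_ hN] := truncn_itv y0; rewrite ltr_pdivrMr // in hN.
have [S [S1 S2 S3 S4]] :=
  discrepancy_bound bOm OD D1 r0 Oc A0 n0 d01 lam0 lamB hN hT' hF hd.
exists S; split=> //; split=> //; split=> //.
(* The bound holds for every line, so the exceptional set is empty. *)
rewrite /disc_le (_ : [set z | _] = set0); first exact: negligible_set0.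
rewrite -subset0 => -[th q] /= [thpi]; apply/negP; rewrite -leNgt S3.
apply: (le_trans (S4 th q thpi)); rewrite b2 -/a -/A -[leRHS]mulrA; set E := a * b ^+ 2 in hF hd hn *.
have a1 : 1 <= a by rewrite -(@expr_ge1 _ 5) ?powR_ge0 // aL.
have E1 : 1 <= E by rewrite /E -[leLHS]mulr1 ler_pM // exprn_ege1.
have pi1 : 1 <= pi :> R by have := @pi_ge2 R; lra.
have h1 : 2 * (K * E) / (pi * A) * (4 * D) <= 8 * K * D / A * E.
  have -> : 8 * K * D / A * E = 2 * (K * E) / A * (4 * D) by ring.
  apply: ler_wpM2r; first by rewrite mulr_ge0.
  apply: ler_wpM2l; first by rewrite mulr_ge0 // mulr_ge0 ?(ltW K0) // (le_trans ler01).
  by rewrite lef_pV2 ?posrE ?mulr_gt0 ?pi_gt0 // ler_peMl // ltW.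
have h2 : 2 * (K * E) / r = 2 * K / r * E by ring.
have -> : (K + 2 + 8 * D / A + (2 * K / r + 1) + 8 * K * D / A) * E =
  K * E + 2 * E + 8 * D / A * E + (2 * K / r * E + E) + 8 * K * D / A * E by ring.
rewrite h2; apply: lerD h1; apply: lerD; last by rewrite lerD2l.
by apply: lerD hn; rewrite lerD2l ler_peMr.
Qed.
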